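(* Let $m>1$ and let $(V_\delta,R_\delta,\sigma_\delta)_{0<\delta<1}$ be a high-energy family of solitary waves (as defined in the context) with associated parameter $\varepsilon_\delta$. For $\varepsilon>0$ define $$\hat\mu_\varepsilon:=\frac{\bar\mu\,\varepsilon}{1+\varepsilon(\bar\kappa-1)},\qquad \hat\sigma_\varepsilon:=\varepsilon^{-m-2}\hat\mu_\varepsilon^2,$$ $$\hat R_\varepsilon(x):=\begin{cases}1-\varepsilon-\varepsilon\,\tilde S_0\big(|x|/\hat\mu_\varepsilon\big)& 0\le|x|<\frac12,\\ \varepsilon\,\tilde T_0\big((1-|x|)/\hat\mu_\varepsilon\big)&\frac12\le|x|<\frac32,\\ 0&\text{else},\end{cases}\qquad \hat V_\varepsilon(x):=\frac{\varepsilon}{\hat\mu_\varepsilon}\begin{cases}\tilde W_0\big((\frac12-|x|)/\hat\mu_\varepsilon\big)&0\le|x|<1,\\0&\text{else}.\end{cases}$$ Then for any $q\in[1,\infty]$, as $\delta\to0$, $$\|R_\delta-\hat R_{\varepsilon_\delta}\|_q+\|V_\delta-\hat V_{\varepsilon_\delta}\|_q+\varepsilon_\delta^m\,|\sigma_\delta-\hat\sigma_{\varepsilon_\delta}|=O(\varepsilon_\delta^m)=O(\delta^m).$$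
   Context: Fix $m\in(1,\infty)$ and $\Phi(r)=\frac{1}{m(m+1)}\big((1-r)^{-m}-mr-1\big)$ for $r<1$. For $V\in L^2(\mathbb R)$ let $(AV)(x)=\int_{x-1/2}^{x+1/2}V(y)\,dy$. A solitary wave is a triple $(V,R,\sigma)$ with $\sigma>0$ satisfying $R=AV$ and $\sigma V=A\Phi'(R)$ on $\mathbb R$ (equivalently, for $V\in L^2$, $R'(x)=V(x+\frac12)-V(x-\frac12)$ and $\sigma V'(x)=\Phi'(R(x+\frac12))-\Phi'(R(x-\frac12))$ for all $x\in\mathbb R$). A function is unimodal if it is increasing for negative $x$ and decreasing for positive $x$. A high-energy family is a family $(V_\delta,R_\delta,\sigma_\delta)_{0<\delta<1}$ of solitary waves such that (i) $V_\delta,R_\delta\in L^2(\mathbb R)\cap BC^1(\mathbb R)$ are nonnegative, even and unimodal; (ii) $\|V_\delta\|_2=1-\delta$ and $R_\delta$ takes values in $[0,1)$; (iii) $p_\delta:=\int_{\mathbb R}\Phi(R_\delta(x))\,dx\to+\infty$ as $\delta\to0$. Set $\varepsilon_\delta:=1-R_\delta(0)$. $\tilde S_0:\mathbb R\to\mathbb R$ is the solution of $\tilde S_0''=\frac{2}{m+1}\,(1+\tilde S_0)^{-(m+1)}$, $\tilde S_0(0)=\tilde S_0'(0)=0$; $\bar\mu:=\frac{2}{\sqrt{m(m+1)}}$, $\bar\kappa:=\int_0^\infty\tilde x\,\tilde S_0''(\tilde x)\,d\tilde x$ (a convergent integral); $\tilde W_0(\tilde x):=\frac12(\tilde S_0'(\tilde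 x)+\bar\mu)$ and $\tilde T_0(\tilde x):=\frac12(\tilde S_0(\tilde x)+\bar\mu\tilde x+\bar\kappa)$. $\|\cdot\|_q$ is the norm of $L^q(\mathbb R)$. $O(\cdot)$ means bounded by a constant (independent of $\delta$) times the argument. *)

(* Defs.v *)
From HB Require Import structures.
From mathcomp Require Import all_boot all_order all_algebra.
From mathcomp Require Import all_classical all_reals all_analysis.

Set Implicit Arguments.
Unset Strict Implicit.
Unset Printing Implicit Defensive.

Import Order.TTheory GRing.Theory Num.Theory.
Import numFieldNormedType.Exports.

Local Open Scope classical_set_scope.
Local Open Scope ring_scope.

(* Real powers are [powR] (infix [`^]).  Every base to which it is applied
   below is positive under the standing hypotheses. *)

Section waves.
Context {K : realType}.
Implicit Types (m sigma x : K) (f V R : K -> K).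

Local Notation mu := (@lebesgue_measure K).

Definition Phi m (r : K) : K :=
  (m * (m + 1))^-1 * ((1 - r) `^ (- m) - m * r - 1).

Definition avg f x : K := (\int[mu]_(y in `[x - 2^-1, x + 2^-1]) f y)%R.

(* [R x < 1] is the domain condition under which Phi'(R) makes sense. *)
Definition solitary_wave m V R sigma : Prop :=
  [/\ V \in Lfun mu 2%:E,
      (forall x, R x < 1),
      0 < sigma,
      (forall x, R x = avg V x) &
      (forall x, sigma * V x = avg (fun y => derive1 (Phi m) (R y)) x)].

Definition BC1 f : Prop :=
  [/\ (forall x, derivable f x 1), continuous (derive1 f),
      bounded_fun f & bounded_fun (derive1 f)].

(* Monotonicity is understood in the weak sense. *)
Definition unimodal f : Prop :=
  {in `]-oo, 0[ &, {homo f : x y / x <= y}} /\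
  {in `]0, +oo[ &, {homo f : x y /~ x <= y}}.

Definition wave_profile f : Prop :=
  [/\ f \in Lfun mu 2%:E, BC1 f, (forall x, 0 <= f x),
      (forall x, f (- x) = f x) & unimodal f].

Record high_energy_family m (V R : K -> K -> K) (sigma : K -> K) : Prop := {
  hef_wave : forall delta : K, 0 < delta < 1 ->
    solitary_wave m (V delta) (R delta) (sigma delta);
  hef_V : forall delta : K, 0 < delta < 1 -> wave_profile (V delta);
  hef_R : forall delta : K, 0 < delta < 1 -> wave_profile (R delta);
  hef_norm : forall delta : K, 0 < delta < 1 ->
    'N[mu]_2%:E[EFin \o V delta]%E = (1 - delta)%:E;
  hef_range : forall delta : K, 0 < delta < 1 ->
    forall x, 0 <= R delta x < 1;
  hef_energy :
    (\int[mu]_x (Phi m (R delta x))%:E)%E @[delta --> 0^'+] --> +oo%E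
}.

Definition amplitude (R : K -> K -> K) (delta : K) : K := 1 - R delta 0.

Definition is_S0 m (S0 : K -> K) : Prop :=
  [/\ (forall x, derivable S0 x 1 /\ derivable (derive1 S0) x 1),
      (forall x, 0 < 1 + S0 x),
      (forall x, derive1n 2 S0 x = 2 / (m + 1) * (1 + S0 x) `^ (- (m + 1))),
      S0 0 = 0 & derive1 S0 0 = 0].

Definition mubar m : K := 2 / Num.sqrt (m * (m + 1)).

Section profiles.
Variables (m : K) (S0 : K -> K).

Definition kappabar : K := (\int[mu]_(x in `[0%R, +oo[) (x * derive1n 2 S0 x))%R.

Definition W0 x : K := 2^-1 * (derive1 S0 x + mubar m).

Definition T0 x : K := 2^-1 * (S0 x + mubar m * x + kappabar).

Definition muhat (eps : K) : K := mubar m * eps / (1 + eps * (kappabar - 1)).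

Definition sigmahat (eps : K) : K := eps `^ (- m - 2) * muhat eps ^+ 2.

Definition Rhat (eps : K) x : K :=
  if `|x| < 2^-1 then 1 - eps - eps * S0 (`|x| / muhat eps)
  else if `|x| < 3 / 2 then eps * T0 ((1 - `|x|) / muhat eps)
  else 0.

Definition Vhat (eps : K) x : K :=
  eps / muhat eps *
  (if `|x| < 1 then W0 ((2^-1 - `|x|) / muhat eps) else 0).

End profiles.
End waves.

(* Main.v *)
Require Import Defs.
From HB Require Import structures.
From mathcomp Require Import all_boot all_order all_algebra.
From mathcomp Require Import all_classical all_reals all_analysis.
From mathcomp Require Import ring lra.
From mathcomp Require Import measurable_realfun ess_sup_inf.

(** Write [D = 1 - R], [eps = D 0].  The Cauchy-Schwarz inequality keeps [R]
below [3/4] outside [-1/2, 1/2], so the large energy forces [eps -> 0] and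
[sigma -> oo], and the force [Phi' (R)] is bounded outside [-1/2, 1/2].  Hence
- inside, [sigma * D'' = 2 / (m + 1) * D ^ -(m + 1) + O(1)]; its first integral
  gives [sigma * eps ^ m ~ 1] and makes [D] a time change of the scaled profile:
  [D x = eps * (1 + S0 (tau x))] with [tau] linear up to a relative error
  [O(eps ^ m)];
- [D' y = V (1/2 - y) - V (1/2 + y)] while [V (1/2 - y) + V (1/2 + y)] equals
  [V 0] up to [O(1 / sigma)], so [D'] determines [V] on [0, 1], and then [R] on
  [1/2, 3/2]; beyond, [V] and [R] decay at each unit step by a factor
  [O(1 / sigma)].
Matching [D] and [D'] with the asymptotics of [S0] at [x = 1/2] yields
[mubar * tau' * eps = 1 + eps * (kappabar - 1) + O(eps ^ m)], which is the
scale of the approximation.  Finally, comparing the two sides of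
[int V ^ 2 = (1 - delta) ^ 2] to first order in [eps] gives
[eps * (1 - 1 / m) <= 2 * delta], up to higher order terms. *)

Set Implicit Arguments.
Unset Strict Implicit.
Unset Printing Implicit Defensive.

Import Order.TTheory GRing.Theory Num.Theory.
Import numFieldNormedType.Exports.

Local Open Scope classical_set_scope.
Local Open Scope ring_scope.

(** The obstacle is uniformity near the crest [x = 0]. There [D'] vanishes, so an absolute error in
    the first integral would be useless. But the derivative of that error is [D'] times a bounded
    rest, so it is at most a multiple of [D - eps], and [D - eps <= 1 - (eps / D) ^ m] because
    [eps <= D <= 1 <= m]. The error is thus relative to the main term all the way down to the crest,
    and becomes a relative error on the clock [tau]. Such an error stays harmless where [tau] is of
    order [1 / eps], since [s'] has a Lipschitz constant [O(1 / t)] at time [t]. The rate [eps ^ m]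
    comes from [S0]: at times [t] of order [1 / eps] its asymptotics have an error [O(t ^ (1 - m))],
    which [D] multiplies by [eps]. The true scale is read off [sigma] itself and is compared with
    the explicit one only after the matching. All norms are treated at once through a pointwise
    bound [O(eps ^ m) / (1 + x ^ 2)]. *)

(** * Calculus on the line: derivatives, comparison, antiderivatives *)

Section calculus.
Context {K : realType}.
Implicit Types (f g P : K -> K) (a b c x y B : K).
Local Notation mu := (@lebesgue_measure K).

(** The [der_*] rules are stated for functions written as abstractions, so that a derivative is
    assembled as a term; [der_conv] then leaves only an algebraic identity. *)
Lemma der_conv f x d1 d2 : is_derive x 1 f d1 -> d1 = d2 -> is_derive x 1 f d2.
Proof. by move=> H <-. Qed.

Lemma der_cst c x : is_derive x 1 (fun _ : K => c) 0.
Proof. exact: is_derive_cst. Qed.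

Lemma der_id x : is_derive x 1 (fun y : K => y) 1.
Proof. exact: is_derive_id. Qed.

Lemma der_opp f x df : is_derive x 1 f df -> is_derive x 1 (fun y => - f y) (- df).
Proof. move=> H; exact: is_deriveN. Qed.

Lemma der_add f g x df dg : is_derive x 1 f df -> is_derive x 1 g dg ->
  is_derive x 1 (fun y => f y + g y) (df + dg).
Proof. move=> H1 H2; exact: is_deriveD. Qed.

Lemma der_mul f g x df dg : is_derive x 1 f df -> is_derive x 1 g dg ->
  is_derive x 1 (fun y => f y * g y) (df * g x + f x * dg).
Proof. by move=> H1 H2; apply: is_derive_eq; rewrite /GRing.scale/= addrC (mulrC (g x)). Qed.

Lemma der_exp f x n df : is_derive x 1 f df ->
  is_derive x 1 (fun y => f y ^+ n.+1) (n.+1%:R * f x ^+ n * df).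
Proof. move=> H; have := is_deriveX n.+1 H.
have -> : f ^+ n.+1 = (fun y => f y ^+ n.+1) by apply/funext => y; rewrite fctE.
by []. Qed.

Lemma der_comp f g x df dg : is_derive (g x) 1 f df -> is_derive x 1 g dg ->
  is_derive x 1 (fun y => f (g y)) (df * dg).
Proof. by move=> H1 H2; apply: is_derive_eq; rewrite /GRing.scale/= mulrC. Qed.

Lemma der_powR f x df p : is_derive x 1 f df -> 0 < f x ->
  is_derive x 1 (fun y => f y `^ p) (p * f x `^ (p - 1) * df).
Proof. by move=> H f0; apply: (@der_comp (fun z => z `^ p)); exact: is_derive1_powR. Qed.

Lemma der_cont f x df : is_derive x 1 f df -> {for x, continuous f}.
Proof. by move=> [H _]; apply/differentiable_continuous/derivable1_diffP. Qed.

Lemma continuous_within_itv f a b : (forall x, a <= x <= b -> {for x, continuous f}) ->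
  {within `[a, b], continuous f}.
Proof.
move=> H; apply: continuous_in_subspaceT => x; rewrite inE/= in_itv/= => xab.
exact: H.
Qed.

Lemma MVTo f f' a b : a < b -> (forall x, a < x < b -> is_derive x 1 f (f' x)) ->
  {within `[a, b], continuous f} ->
  exists2 c, a < c < b & f b - f a = f' c * (b - a).
Proof.
move=> ab df cf; have H x : x \in `]a, b[%R -> is_derive x 1 f (f' x) by rewrite in_itv/=; exact: df.
have [c] := MVT ab H cf.
by rewrite in_itv/= => ? ?; exists c.
Qed.

Lemma MVTc f f' a b : a < b -> (forall x, a <= x <= b -> is_derive x 1 f (f' x)) ->
  exists2 c, a < c < b & f b - f a = f' c * (b - a).
Proof.
move=> ab df; apply: MVTo => // [x /andP[ax xb]|]; first by apply: df; rewrite !ltW.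
by apply: continuous_within_itv => x /df /der_cont.
Qed.

Lemma le_incr_oo f g f' g' a b : a <= b ->
  (forall x, a < x < b -> is_derive x 1 f (f' x)) ->
  (forall x, a < x < b -> is_derive x 1 g (g' x)) ->
  {within `[a, b], continuous f} -> {within `[a, b], continuous g} ->
  (forall x, a < x < b -> f' x <= g' x) -> f b - f a <= g b - g a.
Proof.
rewrite le_eqVlt => /predU1P[->|ab] df dg cf cg fg; first by rewrite !subrr.
have [||c cab] := @MVTo (fun x => g x - f x) (fun x => g' x - f' x) a b ab.
- by move=> x xab; apply: der_add (dg _ xab) (der_opp (df _ xab)).
- by move=> x; apply: continuousB; [exact: cg|exact: cf].
- move=> H; have : 0 <= (g' c - f' c) * (b - a).
    by rewrite mulr_ge0// subr_ge0 ?fg// ltW.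
  by lra.
Qed.

Lemma le_incr f g f' g' a b : a <= b ->
  (forall x, a <= x <= b -> is_derive x 1 f (f' x)) ->
  (forall x, a <= x <= b -> is_derive x 1 g (g' x)) ->
  (forall x, a < x < b -> f' x <= g' x) -> f b - f a <= g b - g a.
Proof.
move=> ab df dg; apply: le_incr_oo => //.
- by move=> x /andP[ax xb]; apply: df; rewrite !ltW.
- by move=> x /andP[ax xb]; apply: dg; rewrite !ltW.
- by apply: continuous_within_itv => x /df /der_cont.
- by apply: continuous_within_itv => x /dg /der_cont.
Qed.

Lemma le_incr_cst f f' a b M : a <= b ->
  (forall x, a <= x <= b -> is_derive x 1 f (f' x)) ->
  (forall x, a < x < b -> f' x <= M) -> f b - f a <= M * (b - a).
Proof.
move=> ab df fM; rewrite mulrBr; apply: (@le_incr _ (fun x : K => M * x) f' (fun=> M)) => // x _.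
by apply: (der_conv (der_mul (der_cst M x) (der_id x))); rewrite mul0r add0r mulr1.
Qed.

Lemma ge_incr_cst f f' a b M : a <= b ->
  (forall x, a <= x <= b -> is_derive x 1 f (f' x)) ->
  (forall x, a < x < b -> M <= f' x) -> M * (b - a) <= f b - f a.
Proof.
move=> ab df fM; rewrite mulrBr; apply: (@le_incr (fun x : K => M * x) _ (fun=> M) f') => // x _.
by apply: (der_conv (der_mul (der_cst M x) (der_id x))); rewrite mul0r add0r mulr1.
Qed.

Lemma le_incr_norm f g f' g' a b : a <= b ->
  (forall x, a <= x <= b -> is_derive x 1 f (f' x)) ->
  (forall x, a <= x <= b -> is_derive x 1 g (g' x)) ->
  (forall x, a < x < b -> `|f' x| <= g' x) -> `|f b - f a| <= g b - g a.
Proof.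
move=> ab df dg fg; rewrite ler_norml; apply/andP; split; last first.
  by apply: (le_incr ab df dg) => x /fg; apply: le_trans; exact: ler_norm.
rewrite lerNl -[leLHS]opprK opprB opprK.
have := @le_incr (fun x => - f x) g (fun x => - f' x) g' a b ab.
rewrite opprK (addrC (- f b)) => H; apply: H => // [x|x /fg].
  by move=> /df; exact: der_opp.
by apply: le_trans; rewrite -normrN ler_norm.
Qed.

(** Keeping the derivative and the integrals together lets integrals appear only where a wave enters
    or leaves the argument; in between, inequalities are compared through derivatives. *)
Definition is_antider P f :=
  (forall x, is_derive x 1 P (f x)) /\
  (forall a b, a <= b -> (\int[mu]_(x in `[a, b]) (f x)%:E)%E = (P b - P a)%:E).

Lemma antider_ex f : continuous f -> exists2 P, P 0 = 0 & is_antider P f.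
Proof.
move=> cf.
have cfi a b : {within `[a, b], continuous f} by apply: continuous_within_itv => x _; exact: cf.
have fi a b : mu.-integrable `[a, b] (EFin \o f).
  by apply: continuous_compact_integrable => //; exact: segment_compact.
pose G (a x : K) := (\int[mu]_(t in `[a, x]) f t)%R.
have GB a x y : a <= x <= y -> (\int[mu]_(t in `[x, y]) f t)%R = G a y - G a x.
  move=> /andP[ax xy]; rewrite /G Rintegral_itvB//.
  by rewrite Rintegral_itv_obnd_cbnd//; apply: integrableS (fi x y) => //; exact: subset_itv_oc_cc.
have dG a x : a < x -> is_derive x 1 (G a) (f x).
  move=> ax; have [] := @continuous_FTC1_closed _ f a x (x + 1) _ _ ax (cf x).
  - by rewrite ltrDl.
  - exact: fi.
  - by move=> dx <-; rewrite derive1E; exact: derivableP.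
(* The orientation is put in by hand. By [PG], [P] equals [G a - G a 0] for every base point
   [a <= 0] to the left, so the fundamental theorem from [a = min 0 x - 1] also covers [x <= 0]. *)
pose P x := if 0 <= x then G 0 x else - G x 0.
have PG a x : a <= 0 -> a <= x -> P x = G a x - G a 0.
  move=> a0 ax; rewrite /P; case: (leP 0 x) => x0.
    by rewrite -(GB a 0 x) ?a0.
  by rewrite /G -/(G x 0) -/(G a x) -/(G a 0) (_ : G x 0 = G a 0 - G a x) ?opprB// -GB ?ax ?ltW.
exists P.
  by rewrite /P lexx /G set_itv1 Rintegral_set1.
split=> [x|a b ab].
  pose a := Num.min 0 x - 1.
  have [a0 ax] : a < 0 /\ a < x by rewrite /a; split; case: (lerP 0 x) => ?; lra.
  have H : is_derive x 1 (fun y => G a y - G a 0) (f x).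
    by apply: (der_conv (der_add (dG _ _ ax) (der_cst _ _))); rewrite addr0.
  apply: (near_eq_is_derive _ H).
  near=> y; rewrite (@PG a)//; first exact: ltW.
  by apply: ltW; near: y; exact: lt_nbhsr.
have -> : P b - P a = (\int[mu]_(t in `[a, b]) f t)%R.
  pose c := Num.min 0 a.
  have [c0 ca] : c <= 0 /\ c <= a by rewrite /c; split; case: (lerP 0 a) => ?; lra.
  rewrite (@PG c b)//; last exact: le_trans ab.
  by rewrite (@PG c a)// (GB c) ?ca//; ring.
by rewrite /Rintegral fineK//; apply: integrable_fin_num.
Unshelve. all: by end_near. Qed.

Lemma antider_odd P f : P 0 = 0 -> (forall x, is_derive x 1 P (f x)) ->
  (forall x, f (- x) = f x) -> forall x, P (- x) = - P x.
Proof.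
move=> P0 dP ev.
have d x : is_derive x 1 (fun y => P y + P (- y)) 0.
  apply: (der_conv (der_add (dP x) (der_comp (dP (- x)) (der_opp (der_id x))))).
  by rewrite ev; ring.
have H x : 0 <= x -> P (- x) = - P x.
  move=> x0.
  have := @le_incr_cst _ (fun=> 0) 0 x 0 x0 (fun y _ => d y) (fun _ _ => lexx _).
  have := @ge_incr_cst _ (fun=> 0) 0 x 0 x0 (fun y _ => d y) (fun _ _ => lexx _).
  by rewrite oppr0 P0; lra.
move=> x; case: (leP 0 x) => [/H//|/ltW]; rewrite -oppr_ge0 => /H.
by rewrite opprK => ->; rewrite opprK.
Qed.

(** By evenness and monotone convergence, the intervals [[0, n]] suffice. *)
Lemma even_integral_le P f B : (forall x, 0 <= f x) -> (forall x, f (- x) = f x) ->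
  continuous f -> is_antider P f -> (forall n : nat, P n%:R - P 0 <= B) ->
  (\int[mu]_x (f x)%:E <= (2 * B)%:E)%E.
Proof.
move=> f0 ev cf [_ PI] PB; rewrite ge0_symfun_integralT//; last by move=> x; rewrite /= ev.
rewrite EFinM lee_wpmul2l// -set_itvcy ge0_integral_ereal_sup//; last exact: continuous_measurable_fun.
by apply: ge_ereal_sup => _ [n _ <-]; rewrite PI// lee_fin.
Qed.

Lemma even_integral_ge P f x : (forall x, 0 <= f x) -> (forall x, f (- x) = f x) ->
  continuous f -> is_antider P f -> 0 <= x ->
  ((2 * (P x - P 0))%:E <= \int[mu]_x (f x)%:E)%E.
Proof.
move=> f0 ev cf [_ PI] x0; rewrite ge0_symfun_integralT//; last by move=> y; rewrite /= ev.
rewrite EFinM lee_wpmul2l//.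
rewrite -set_itvcy -PI//; apply: ge0_subset_integral => //=.
- by apply/measurable_EFinP; apply: measurable_funTS; exact: continuous_measurable_fun.
- by move=> y _; rewrite lee_fin.
- exact: subset_itvl.
Qed.

End calculus.

(** * Norms of functions with quadratic decay *)

Section norms.
Context {K : realType}.
Implicit Types (f g P : K -> K) (a b c x y B A r : K).
Local Notation mu := (@lebesgue_measure K).

Lemma antider_derive P f : continuous f -> (forall x, is_derive x 1 P (f x)) -> is_antider P f.
Proof.
move=> cf dP; have [G _ [dG GI]] := antider_ex cf; split=> // a b ab.
rewrite GI//; congr EFin; apply/eqP; rewrite eq_le.
by rewrite (le_incr ab (fun x _ => dG x) (fun x _ => dP x)) ?(le_incr ab (fun x _ => dP x) (fun x _ => dG x)).
Qed.

Lemma ge0_integral_le (f g : K -> \bar K) : (forall x, 0 <= f x)%E ->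
  (forall x, f x <= g x)%E -> (\int[mu]_x f x <= \int[mu]_x g x)%E.
Proof.
move=> f0 fg; have g0 x : (0 <= g x)%E by exact: le_trans (fg x).
rewrite !ge0_integralTE//; apply: le_ereal_sup => _ [h hf <-]; exists h => // x.
exact: le_trans (hf x) (fg x).
Qed.

(** One weight serves all exponents: it is at most [1] and its integral is [pi]. *)
Definition bump x : K := (1 + x ^+ 2)^-1.

Lemma bump_gt0 x : 0 < bump x.
Proof. by rewrite invr_gt0 ltr_wpDr// sqr_ge0. Qed.

Lemma bump_le1 x : bump x <= 1.
Proof. by rewrite invf_le1 ?ltr_wpDr ?sqr_ge0// lerDl sqr_ge0. Qed.

Lemma int_bump_le A : 0 <= A -> (\int[mu]_x (A * bump x)%:E <= (A * pi)%:E)%E.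
Proof.
move=> A0.
have cb : continuous (fun x => A * bump x).
  by move=> x; apply: cvgM; [exact: cvg_cst|exact: continuous_oneDsqrV].
have d x : is_derive x 1 (fun y => A * atan y) (A * bump x).
  by apply: (der_conv (der_mul (der_cst A x) (is_derive1_atan x))); rewrite mul0r add0r.
have -> : A * pi = 2 * (A * (pi / 2)) by field.
apply: (@even_integral_le _ (fun y => A * atan y)) => //.
- by move=> x; rewrite mulr_ge0// ltW// bump_gt0.
- by move=> x; rewrite /bump sqrrN.
- exact: antider_derive.
- move=> n; rewrite atan0 mulr0 subr0 ler_wpM2l// ltW//; exact: atan_ltpi2.
Qed.

(** For a finite exponent [r >= 1], [bump ^ r <= bump] bounds the integral by [A ^ r * pi], and
    [pi <= (1 + pi) ^ r]. The constant therefore does not depend on the exponent. *)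
Lemma Lnorm_decay f A (q : \bar K) : 0 <= A -> (1 <= q)%E ->
  (forall x, `|f x| <= A * bump x) ->
  ('N[mu]_q[EFin \o f] <= (A * (1 + pi))%:E)%E.
Proof.
move=> A0 q1 fA; have pi0 : 0 <= pi :> K by exact: pi_ge0.
have fA' x : `|f x| <= A.
  by apply: le_trans (fA x) _; rewrite -[leRHS]mulr1 ler_wpM2l// bump_le1.
rewrite unlock; case: q q1 => [r| |] //; last first.
  move=> _; case: ifPn => _; last by rewrite lee_fin mulr_ge0// addr_ge0.
  apply/ess_supP; apply: nearW => x /=; rewrite lee_fin.
  by apply: le_trans (fA' x) _; rewrite -[leLHS]mulr1 ler_wpM2l// lerDl.
rewrite lee_fin => r1; have r0 : 0 < r by exact: lt_le_trans r1.
have rn0 : r != 0 by rewrite gt_eqF.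
have Api : 0 <= A * (1 + pi) by rewrite mulr_ge0// addr_ge0.
have -> : (A * (1 + pi))%:E = (((A * (1 + pi))%:E `^ r) `^ r^-1)%E.
  by rewrite !poweR_EFin -powRrM mulfV// powRr1.
apply: gt0_ler_poweR; rewrite ?invr_ge0 ?(ltW r0)// ?in_itv/= ?leey ?andbT.
- by apply: integral_ge0 => x _; rewrite lee_fin powR_ge0.
- by rewrite lee_fin powR_ge0.
have pi1 : 0 <= 1 + pi :> K by exact: addr_ge0.
rewrite powRM//.
apply: (@le_trans _ _ (\int[mu]_x (A `^ r * bump x)%:E)%E).
  apply: ge0_integral_le => x /=; rewrite lee_fin ?powR_ge0//.
  apply: (@le_trans _ _ ((A * bump x) `^ r)).
    by apply: ge0_ler_powR => //; [exact: ltW|rewrite nnegrE mulr_ge0// ltW// bump_gt0].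
  rewrite powRM//; last by rewrite ltW// bump_gt0.
  by rewrite ler_wpM2l// ?powR_ge0// ge1r_powR// bump_gt0 bump_le1.
apply: le_trans (int_bump_le _) _; first exact: powR_ge0.
rewrite lee_fin ler_wpM2l ?powR_ge0//.
apply: (@le_trans _ _ (1 + pi)); first by rewrite lerDr.
by apply: le1r_powR => //; rewrite lerDl.
Qed.

(* The constant [4] is such that [bump] loses at most this factor over a unit step. *)
Lemma bump_decay (f : K -> K) A x : (forall y, 0 <= y <= 1 -> f y <= A) ->
  (forall y, 0 <= y -> f (y + 1) <= f y / 4) -> 0 <= A -> 0 <= x ->
  f x <= 2 * A * bump x.
Proof.
move=> f1 fd A0 x0.
have key n : forall y, n%:R <= y < n.+1%:R -> f y <= 2 * A * bump y.
  elim: n => [|n IH] y /andP[ny yn].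
    apply: le_trans (f1 y _) _; first by rewrite ny ltW.
    rewrite -mulrA (mulrC 2) -mulrA -[leLHS]mulr1 ler_wpM2l//.
    rewrite ler_pdivlMl ?mulr1 ?ltr_wpDr ?sqr_ge0//.
    by nra.
  have y1 : n%:R <= y - 1 < n.+1%:R.
    by move: ny yn; rewrite -!natr1 => ? ?; apply/andP; split; lra.
  have yge : 0 <= y - 1 by move: y1 => /andP[y1 _]; exact: le_trans y1.
  have := fd (y - 1) yge; rewrite subrK => /le_trans; apply.
  apply: (@le_trans _ _ (2 * A * bump (y - 1) / 4)); first by rewrite ler_pM2r ?invr_gt0// IH.
  rewrite -!mulrA ler_wpM2l// ler_wpM2l// /bump -invfM lef_pV2 ?posrE; last 2 first.
  - by rewrite mulr_gt0// ltr_wpDr ?sqr_ge0.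
  - by rewrite ltr_wpDr ?sqr_ge0.
  (* Indeed [3 * (4 * (1 + (y - 1) ^ 2) - (1 + y ^ 2)) = (3 * y - 4) ^ 2 + 5]. *)
  by have := sqr_ge0 (3 * y - 4); nra.
have := @truncn_itv K x x0; exact: key.
Qed.

End norms.

(** * The potential [Phi] and the force [Phi'] *)

Section potential.
Context {K : realType}.
Variable m : K.
Hypothesis m1 : 1 < m.
Implicit Types (a b c x y r s : K).

Let m0 : 0 < m. Proof. exact: lt_trans m1. Qed.
Let m10 : 0 < m + 1. Proof. exact: addr_gt0. Qed.

Lemma powRN_le p x y : 0 <= p -> 0 < x -> x <= y -> y `^ (- p) <= x `^ (- p).
Proof.
move=> p0 x0 xy; have y0 := lt_le_trans x0 xy.
by rewrite !powRN lef_pV2 ?posrE ?powR_gt0// ge0_ler_powR// nnegrE ltW.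
Qed.

(** This is [Phi'] on [r < 1]. *)
Definition force r : K := (m + 1)^-1 * ((1 - r) `^ (- (m + 1)) - 1).

Lemma der_Phi r : r < 1 -> is_derive r 1 (Phi m) (force r).
Proof.
move=> r1; have r0 : 0 < 1 - r by lra.
have d1 : is_derive r 1 (fun y : K => 1 - y) (-1).
  by apply: (der_conv (der_add (der_cst 1 r) (der_opp (der_id r)))); rewrite add0r.
have d2 := der_powR (- m) d1 r0.
apply: (der_conv (der_mul (der_cst _ r) (der_add (der_add d2 (der_opp (der_mul (der_cst m r) (der_id r)))) (der_opp (der_cst 1 r))))).
rewrite /force (_ : - m - 1 = - (m + 1)); last by ring.
by field; rewrite (gt_eqF m0) (gt_eqF m10).
Qed.

Lemma derive1_Phi r : r < 1 -> derive1 (Phi m) r = force r.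
Proof. by move=> /der_Phi[_ <-]; rewrite derive1E. Qed.

Lemma der_force r : r < 1 -> is_derive r 1 force ((1 - r) `^ (- (m + 2))).
Proof.
move=> r1; have r0 : 0 < 1 - r by lra.
have d1 : is_derive r 1 (fun y : K => 1 - y) (-1).
  by apply: (der_conv (der_add (der_cst 1 r) (der_opp (der_id r)))); rewrite add0r.
have d2 := der_powR (- (m + 1)) d1 r0.
apply: (der_conv (der_mul (der_cst _ r) (der_add d2 (der_opp (der_cst 1 r))))).
rewrite (_ : - (m + 1) - 1 = - (m + 2)); last by ring.
by field; rewrite gt_eqF// addr_gt0.
Qed.

Lemma force0 : force 0 = 0.
Proof. by rewrite /force subr0 powR1 subrr mulr0. Qed.

Lemma Phi0 : Phi m 0 = 0.
Proof. by rewrite /Phi subr0 powR1 mulr0 subr0 subrr mulr0. Qed.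

Lemma force_mono r s : r <= s -> s < 1 -> force r <= force s.
Proof.
move=> rs s1; rewrite /force ler_wpM2l ?invr_ge0 ?(ltW m10)//.
by rewrite lerD2r powRN_le ?(ltW m10)//; lra.
Qed.

Lemma force_ge0 r : 0 <= r -> r < 1 -> 0 <= force r.
Proof. by move=> r0 r1; rewrite -force0; exact: force_mono. Qed.

(** The value of [Phi''] at [3 / 4], hence its maximum on [[0, 3 / 4]], which is the range of [R]
    away from the crest. *)
Definition linear_force_bound : K := (1 - 3 / 4) `^ (- (m + 2)).

Lemma linear_force_bound_gt0 : 0 < linear_force_bound.
Proof. by rewrite powR_gt0//; lra. Qed.

Lemma force_linear r : 0 <= r -> r <= 3 / 4 -> force r <= linear_force_bound * r.
Proof.
move=> r0 r1; have := @le_incr_cst _ force (fun r => (1 - r) `^ (- (m + 2))) 0 r linear_force_bound r0.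
rewrite force0 !subr0; apply.
  by move=> x /andP[x0 xr]; apply: der_force; lra.
by move=> x /andP[x0 xr]; apply: powRN_le; have := m0; lra.
Qed.

Lemma Phi_mono r s : 0 <= r -> r <= s -> s < 1 -> Phi m r <= Phi m s.
Proof.
move=> r0 rs s1; rewrite -subr_ge0.
have := @ge_incr_cst _ (Phi m) force r s 0 rs; rewrite mul0r; apply => x /andP[x0 xr].
  by apply: der_Phi; lra.
by apply: force_ge0; lra.
Qed.

Lemma Phi_ge0 r : 0 <= r -> r < 1 -> 0 <= Phi m r.
Proof. by move=> r0 r1; rewrite -Phi0; exact: Phi_mono. Qed.

Lemma Phi_le r : 0 <= r -> r < 1 -> Phi m r <= force r * r.
Proof.
move=> r0 r1; have := @le_incr_cst _ (Phi m) force 0 r (force r) r0.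
rewrite Phi0 !subr0; apply => x /andP[x0 xr].
  by apply: der_Phi; lra.
by apply: force_mono; lra.
Qed.

Lemma Phi_le_pow r : 0 <= r -> r < 1 -> Phi m r <= (1 - r) `^ (- m).
Proof.
move=> r0 r1; rewrite /Phi.
have p0 : 0 <= (1 - r) `^ (- m) by exact: powR_ge0.
rewrite mulrC ler_pdivrMr; last by rewrite mulr_gt0// addr_gt0.
have ? : 0 <= m * r by rewrite mulr_ge0// ltW.
have ? : 1 <= m * (m + 1) by have := m1; nra.
by nra.
Qed.

End potential.

(** * The limit profile [S0]: first integral, asymptotics, comparison *)

Section S0theory.
Context {K : realType}.
Variables (m : K) (S0 : K -> K).
Hypotheses (m1 : 1 < m) (hS : is_S0 m S0).
Implicit Types (a b c x y t u : K).
Local Notation s' := (derive1 S0).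

Let m0 : 0 < m. Proof. exact: lt_trans m1. Qed.
Let m10 : 0 < m + 1. Proof. exact: addr_gt0. Qed.

(** The second derivative of [S0], as prescribed by its equation. *)
Definition s2 t : K := 2 / (m + 1) * (1 + S0 t) `^ (- (m + 1)).

Lemma S0_pos t : 0 < 1 + S0 t. Proof. by case: hS. Qed.

Lemma S0_0 : S0 0 = 0. Proof. by case: hS. Qed.

Lemma dS0_0 : s' 0 = 0. Proof. by case: hS. Qed.

Lemma der_S0 t : is_derive t 1 S0 (s' t).
Proof. by case: hS => H _ _ _ _; have [d _] := H t; apply: (der_conv (derivableP d)); rewrite derive1E. Qed.

Lemma der_dS0 t : is_derive t 1 s' (s2 t).
Proof.
case: hS => H _ E _ _; apply: (der_conv (derivableP (H t).2)).
by rewrite /s2 -E /= derive1E.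
Qed.

Lemma derive1n2E t : derive1n 2 S0 t = s2 t.
Proof. by case: hS. Qed.

Lemma s2_gt0 t : 0 < s2 t.
Proof. by rewrite mulr_gt0 ?powR_gt0 ?S0_pos// divr_gt0// addr_gt0. Qed.

Lemma mubar_gt0 : 0 < mubar m.
Proof. by rewrite divr_gt0// sqrtr_gt0 mulr_gt0// addr_gt0. Qed.

Lemma mubar2 : mubar m ^+ 2 = 4 / (m * (m + 1)).
Proof.
rewrite /mubar expr_div_n sqr_sqrtr ?mulr_ge0 ?addr_ge0 ?ltW//.
by congr (_ / _); ring.
Qed.

Lemma der_powS t : is_derive t 1 (fun y => (1 + S0 y) `^ (- m))
  (- m * (1 + S0 t) `^ (- (m + 1)) * s' t).
Proof.
have d1 : is_derive t 1 (fun y => 1 + S0 y) (s' t).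
  by apply: (der_conv (der_add (der_cst 1 t) (der_S0 t))); rewrite add0r.
apply: (der_conv (der_powR (- m) d1 (S0_pos t))).
by rewrite (_ : - m - 1 = - (m + 1)); last by ring.
Qed.

(** The first integral, obtained from the equation multiplied by [2 * s']. It shows [mubar] to be
    the limiting slope. *)
Lemma S0_energy t : 0 <= t -> s' t ^+ 2 = mubar m ^+ 2 * (1 - (1 + S0 t) `^ (- m)).
Proof.
move=> t0.
have d x : is_derive x 1 (fun y => s' y ^+ 2 - mubar m ^+ 2 * (1 - (1 + S0 y) `^ (- m))) 0.
  apply: (der_conv (der_add (der_exp 1 (der_dS0 x)) (der_opp (der_mul (der_cst _ x) (der_add (der_cst 1 x) (der_opp (der_powS x))))))).
  rewrite mubar2 /s2 expr1 mul0r !add0r.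
  by field; rewrite (gt_eqF m0) (gt_eqF m10).
have := @le_incr_cst _ _ (fun=> 0) 0 t 0 t0 (fun y _ => d y) (fun _ _ => lexx _).
have := @ge_incr_cst _ _ (fun=> 0) 0 t 0 t0 (fun y _ => d y) (fun _ _ => lexx _).
rewrite S0_0 dS0_0 addr0 powR1; lra.
Qed.

Lemma dS0_lt t u : t < u -> s' t < s' u.
Proof.
move=> tu; have [c _] := MVTc tu (fun x _ => der_dS0 x).
have := s2_gt0 c; have : 0 < u - t by lra.
by move=> ? ? H; rewrite -subr_gt0 H mulr_gt0.
Qed.

Lemma dS0_le t u : t <= u -> s' t <= s' u.
Proof. by rewrite le_eqVlt => /predU1P[->//|/dS0_lt/ltW]. Qed.

Lemma dS0_gt0 t : 0 < t -> 0 < s' t.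
Proof. by rewrite -{2}dS0_0; exact: dS0_lt. Qed.

Lemma dS0_ge0 t : 0 <= t -> 0 <= s' t.
Proof. by rewrite -{2}dS0_0; exact: dS0_le. Qed.

Lemma S0_lt t u : 0 <= t -> t < u -> S0 t < S0 u.
Proof.
move=> t0 tu; have [c /andP[tc _]] := MVTc tu (fun x _ => der_S0 x).
have := dS0_gt0 (le_lt_trans t0 tc); have : 0 < u - t by lra.
by move=> ? ? H; rewrite -subr_gt0 H mulr_gt0.
Qed.

Lemma S0_le t u : 0 <= t -> t <= u -> S0 t <= S0 u.
Proof. by move=> t0; rewrite le_eqVlt => /predU1P[->//|/(S0_lt t0)/ltW]. Qed.

Lemma S0_gt0 t : 0 < t -> 0 < S0 t.
Proof. by rewrite -{2}S0_0; exact: S0_lt. Qed.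

Lemma S0_ge0 t : 0 <= t -> 0 <= S0 t.
Proof. by rewrite -{2}S0_0; exact: S0_le. Qed.

Lemma dS0_le_mubar t : s' t <= mubar m.
Proof.
have [t0|t0] := leP 0 t; last first.
  by apply: (@le_trans _ _ 0); [rewrite -dS0_0 dS0_le// ltW|exact/ltW/mubar_gt0].
rewrite -(ler_pXn2r (n := 2))// ?nnegrE ?dS0_ge0//; last exact/ltW/mubar_gt0.
rewrite S0_energy// -[leRHS]mulr1 ler_wpM2l ?sqr_ge0//.
by have := powR_ge0 (1 + S0 t) (- m); lra.
Qed.

Lemma s2_anti t u : 0 <= t -> t <= u -> s2 u <= s2 t.
Proof.
move=> t0 tu; rewrite /s2 ler_wpM2l ?divr_ge0 ?(ltW m10)//.
by apply: powRN_le; [exact: ltW|exact: S0_pos|have := S0_le t0 tu; lra].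
Qed.

(** As [s2] is nonincreasing, [t * s2 t] is at most its integral [s' t] over [[0, t]]. *)
Lemma s2_le t : 0 < t -> s2 t <= mubar m / t.
Proof.
move=> t0; rewrite ler_pdivlMr//; apply: le_trans (dS0_le_mubar t).
have := @ge_incr_cst _ s' s2 0 t (s2 t) (ltW t0) (fun x _ => der_dS0 x).
rewrite dS0_0 !subr0; apply => x /andP[x0 xt].
by apply: s2_anti; exact: ltW.
Qed.

Lemma S0_lip t u : t <= u -> 0 <= t -> `|S0 u - S0 t| <= mubar m * (u - t).
Proof.
move=> tu t0; rewrite ger0_norm ?subr_ge0 ?S0_le//.
by apply: le_incr_cst tu (fun x _ => der_S0 x) _ => x _; exact: dS0_le_mubar.
Qed.

(** The division by [t] is what allows a relative error on the argument of [s'], however large the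
    argument. *)
Lemma dS0_lip t u : 0 < t -> t <= u -> `|s' u - s' t| <= mubar m * (u - t) / t.
Proof.
move=> t0 tu; rewrite ger0_norm ?subr_ge0 ?dS0_le//.
rewrite mulrAC; apply: le_incr_cst tu (fun x _ => der_dS0 x) _ => x /andP[tx _].
by apply: le_trans (s2_le t0); apply: s2_anti; exact: ltW.
Qed.

Lemma S0_lower : exists2 a, 0 < a & forall t, 0 <= t -> a * t <= 1 + S0 t.
Proof.
pose a := Num.min (s' 1) 1.
have [a0 a1 a2] : [/\ 0 < a, a <= 1 & a <= s' 1].
  by rewrite /a; have := dS0_gt0 (@ltr01 K); case: (lerP (s' 1) 1) => ? ?; split; lra.
exists a => // t t0; have [t1|t1] := leP t 1.
  by have := S0_ge0 t0; nra.
(* By convexity, [S0] lies above its tangent at [1]. *)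
have : s' 1 * (t - 1) <= S0 t - S0 1.
  by apply: ge_incr_cst (ltW t1) (fun x _ => der_S0 x) _ => x /andP[/ltW/dS0_le].
have := S0_gt0 (@ltr01 K).
by nra.
Qed.

(* It increases to [kappabar], and is the defect in the asymptotics
   [S0 t = mubar * t - kappabar + o(1)]. *)
Definition legendre t : K := t * s' t - S0 t.

Lemma der_legendre t : is_derive t 1 legendre (t * s2 t).
Proof.
apply: (der_conv (der_add (der_mul (der_id t) (der_dS0 t)) (der_opp (der_S0 t)))).
by ring.
Qed.

Lemma legendre_mono t u : 0 <= t -> t <= u -> legendre t <= legendre u.
Proof.
move=> t0 tu; rewrite -subr_ge0.
have := @ge_incr_cst _ legendre _ t u 0 tu (fun x _ => der_legendre x).
rewrite mul0r; apply => x /andP[tx _].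
by rewrite mulr_ge0 ?ltW ?s2_gt0// (le_lt_trans t0).
Qed.

(** The derivative [t * s2 t] is [O(t ^ -m)] by the linear lower bound on [1 + S0]. The constant is
    chosen so that [- C * t ^ (1 - m)] has a larger derivative; [1 < m] makes the tail finite. *)
Lemma legendre_tail : exists2 C, 0 < C & forall t u, 0 < t -> t <= u ->
  legendre u - legendre t <= C * t `^ (1 - m).
Proof.
have [a a0 aS] := S0_lower.
pose C := 2 / (m + 1) * a `^ (- (m + 1)) / (m - 1).
have C0 : 0 < C.
  by rewrite divr_gt0 ?subr_gt0// mulr_gt0 ?powR_gt0// divr_gt0// addr_gt0.
have CE : C * (m - 1) = 2 / (m + 1) * a `^ (- (m + 1)) by rewrite divfK// gt_eqF// subr_gt0.
clearbody C; exists C => // t u t0 tu.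
have G := @le_incr _ legendre (fun x => - C * x `^ (1 - m)) _ (fun x => C * (m - 1) * x `^ (- m)) t u tu
  (fun x _ => der_legendre x).
have pu : 0 <= C * u `^ (1 - m) by rewrite mulr_ge0 ?powR_ge0 ?ltW.
apply: (le_trans (G _ _)) => [x /andP[tx xu]|x /andP[tx xu]|]; last by lra.
  have x0 := lt_le_trans t0 tx.
  apply: (der_conv (der_mul (der_cst (- C) x) (is_derive1_powR _ x0))).
  by rewrite (_ : 1 - m - 1 = - m); ring.
have x0 := lt_trans t0 tx.
have -> : x `^ (- m) = x * x `^ (- (m + 1)).
  have -> : - m = 1 - (m + 1) by ring.
  by rewrite powRD ?(gt_eqF x0) ?implybT// powRr1// ltW.
rewrite [leRHS]mulrCA ler_wpM2l ?(ltW x0)// /s2 CE -!mulrA ler_wpM2l// ler_wpM2l ?invr_ge0 ?(ltW m10)//.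
rewrite -powRM ?(ltW a0) ?(ltW x0)//; apply: powRN_le; rewrite ?mulr_gt0 ?addr_ge0 ?(ltW m0)//.
by apply: aS; exact: ltW.
Qed.

Lemma kappabarE : exists2 C, 0 < C & forall t, 0 < t ->
  0 <= kappabar S0 - legendre t <= C * t `^ (1 - m).
Proof.
have [C C0 HC] := legendre_tail.
(* The convergence theorem asks for monotonicity on the whole line, and [legendre] decreases on the
   negative half; hence the truncation. *)
pose f (t : K) := legendre (Num.max t 0).
have maxge (t : K) : 0 <= Num.max t 0 by rewrite le_max lexx orbT.
have nd : nondecreasing_fun f.
  by move=> t u tu; apply: legendre_mono => //; exact: le_max2.
have ub t : 0 < t -> ubound (range f) (legendre t + C * t `^ (1 - m)).
  move=> t0 _ [u _ <-].
  have P0 : 0 <= C * t `^ (1 - m) by rewrite mulr_ge0 ?powR_ge0// ltW.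
  have [tu|ut] := leP t (Num.max u 0); first by have := HC _ _ t0 tu; rewrite /f; lra.
  by have := legendre_mono (maxge u) (ltW ut); rewrite /f; lra.
have hub : has_ubound (range f) by exists (legendre 1 + C * 1 `^ (1 - m)); exact: ub.
have cf := nondecreasing_cvgr nd hub.
have cl : legendre x @[x --> +oo] --> sup (range f).
  apply: cvg_trans cf; apply: near_eq_cvg; near=> x.
  rewrite /f max_l//; near: x; exact: nbhs_pinfty_ge.
have -> : kappabar S0 = sup (range f).
  rewrite /kappabar.
  rewrite (@Rintegral_ge0_continuous_FTC2y _ _ legendre _ (sup (range f))).
  - by rewrite /legendre mul0r S0_0 !subr0.
  - by move=> x x0; rewrite derive1n2E mulr_ge0// ltW// s2_gt0.
  - have -> : (fun x => x * derive1n 2 S0 x) = (fun x => x * s2 x).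
      by apply/funext => x; rewrite derive1n2E.
    apply: continuous_subspaceT => x; apply: cvgM; first exact: cvg_id.
    apply: (@der_cont _ s2 x (2 / (m + 1) * (- (m + 1) * (1 + S0 x) `^ (- (m + 1) - 1) * (0 + s' x)))).
    apply: (der_conv (der_mul (der_cst _ x) (der_powR _ (der_add (der_cst 1 x) (der_S0 x)) (S0_pos x)))).
    by rewrite mul0r add0r.
  - exact: cl.
  - by move=> x _; case: (der_legendre x).
  - by apply: cvg_at_right_filter; exact: der_cont (der_legendre 0).
  - by move=> x _; rewrite derive1n2E; case: (der_legendre x) => _ <-; rewrite derive1E.
exists C => // t t0; apply/andP; split.
  rewrite subr_ge0; apply: ub_le_sup => //; exists t => //.
  by rewrite /f max_l// ltW.
rewrite lerBlDl; apply: ge_sup; first by exists (f 0), 0.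
exact: ub.
Unshelve. all: by end_near. Qed.

(** The first integral gives [(mubar - s') * mubar <= mubar ^ 2 - s' ^ 2 = mubar ^ 2 * (1 + S0) ^
    -m], which is the slope estimate. The deviation from the asymptote is then the difference of
    [kappabar - legendre t] and [t * (mubar - s' t)], both nonnegative and [O(t ^ (1 - m))]. *)
Lemma S0_asymp : exists2 C, 0 < C & forall t, 0 < t ->
  `|S0 t - (mubar m * t - kappabar S0)| <= C * t `^ (1 - m) /\
  0 <= mubar m - s' t <= C * t `^ (- m).
Proof.
have [a a0 aS] := S0_lower; have [C C0 HC] := kappabarE.
have mb := mubar_gt0.
pose B := mubar m * a `^ (- m).
have B0 : 0 < B by rewrite mulr_gt0// powR_gt0.
have H t : 0 < t -> 0 <= mubar m - s' t <= B * t `^ (- m).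
  move=> t0; have := S0_energy (ltW t0); have := dS0_le_mubar t; have := dS0_gt0 t0.
  have : (1 + S0 t) `^ (- m) <= a `^ (- m) * t `^ (- m).
    rewrite -powRM ?(ltW a0) ?(ltW t0)//; apply: powRN_le; rewrite ?mulr_gt0 ?(ltW m0)//.
    by apply: aS; exact: ltW.
  rewrite /B -mulrA; set P := _ `^ _; set Q := _ * _ `^ (- m); move=> PQ s0 sm E.
  apply/andP; split; first by lra.
  have : (mubar m - s' t) * mubar m <= mubar m ^+ 2 * P by nra.
  move=> E2; have : (mubar m - s' t) <= mubar m * P by rewrite -(ler_pM2r mb); nra.
  by move=> E3; apply: (le_trans E3); rewrite ler_pM2l.
exists (B + C) => [|t t0]; first exact: addr_gt0.
have p0 := powR_gt0 (- m) t0; have p1 := powR_gt0 (1 - m) t0.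
have E : t `^ (1 - m) = t * t `^ (- m).
  by rewrite powRD ?(gt_eqF t0) ?implybT// powRr1// ltW.
have /andP[h1 h2] := H t t0; have /andP[h3 h4] := HC t t0.
split; last by apply/andP; split => //; nra.
have -> : S0 t - (mubar m * t - kappabar S0) =
    (kappabar S0 - legendre t) - t * (mubar m - s' t) by rewrite /legendre; ring.
have : 0 <= t * (mubar m - s' t) <= B * t `^ (1 - m).
  by rewrite E mulr_ge0 ?(ltW t0)//= mulrCA ler_pM2l.
by move=> /andP[h5 h6]; rewrite ler_norml mulrDl; apply/andP; split; nra.
Qed.

Lemma S0_inv_ex : exists G : K -> K, forall s : K, 0 <= s -> 0 <= G s /\ S0 (G s) = s.
Proof.
have [a a0 aS] := S0_lower.
suff /boolp.choice[G HG] : forall s : K, exists t : K, 0 <= s -> 0 <= t /\ S0 t = s by exists G.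
move=> s.
have [s0|s0] := leP 0 s; last by exists 0.
pose T := (1 + s) / a.
have T0 : 0 <= T by rewrite divr_ge0 ?addr_ge0// ltW.
have TS : s <= S0 T.
  by have := aS T T0; rewrite /T mulrC divfK ?gt_eqF// lerD2l.
have cS : {within `[0, T], continuous S0}.
  by apply: continuous_within_itv => x _; exact: der_cont (der_S0 x).
have [|c] := IVT T0 cS (v := s).
  rewrite S0_0 min_l ?max_r//; first by rewrite s0.
  - exact: S0_ge0.
  - exact: S0_ge0.
by rewrite in_itv/= => /andP[c0 _] Ec; exists c.
Qed.

(* The conclusion on [tau' = S1 / s' (tau)] is integrated only from some [x1 > 0],
   since [s' 0 = 0] makes [S0] non-invertible, as a smooth map, at [0]. *)
Lemma time_change (S S1 : K -> K) (b lam k : K) :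
  0 < lam -> 0 <= k <= 1 -> S 0 = 0 ->
  (forall x, 0 <= x <= b -> is_derive x 1 S (S1 x)) ->
  (forall x, 0 < x <= b -> 0 < S x) ->
  (forall x, 0 <= x <= b -> 0 <= S1 x) ->
  (forall x, 0 <= x <= b ->
    `|S1 x ^+ 2 - lam ^+ 2 * (mubar m ^+ 2 * (1 - (1 + S x) `^ (- m)))|
     <= k * (lam ^+ 2 * (mubar m ^+ 2 * (1 - (1 + S x) `^ (- m))))) ->
  exists tau : K -> K, forall x, 0 <= x <= b ->
    [/\ 0 <= tau x, S x = S0 (tau x), `|tau x - lam * x| <= k * lam * x
      & `|S1 x - lam * s' (tau x)| <= k * lam * s' (tau x)].
Proof.
move=> lam0 /andP[k0 k1] S00 dS Spos S1pos ES.
have [G HG] := S0_inv_ex.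
have Sge x : 0 <= x <= b -> 0 <= S x.
  move=> /andP[]; rewrite le_eqVlt => /predU1P[<-|x0 xb]; first by rewrite S00.
  by apply/ltW/Spos; rewrite x0.
have Gpos (s : K) : 0 < s -> 0 < G s.
  move=> s0; have [g0 gE] := HG s (ltW s0).
  by rewrite lt_neqAle g0 andbT; apply/eqP => g; move: gE s0; rewrite -g S0_0 => <-; rewrite ltxx.
have GK t : 0 <= t -> G (S0 t) = t.
  move=> t0; have [g0 gE] := HG (S0 t) (S0_ge0 t0).
  have [gt|gt|//] := ltgtP (G (S0 t)) t.
  - by have := S0_lt g0 gt; rewrite gE ltxx.
  - by have := S0_lt t0 gt; rewrite gE ltxx.
pose tau x := G (S x).
(* Passing to square roots keeps the relative error [k]: [1 + k <= (1 + k) ^ 2], and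
   [(1 - k) ^ 2 <= 1 - k] because [0 <= k <= 1]. *)
have rE x : 0 <= x <= b -> `|S1 x - lam * s' (tau x)| <= k * lam * s' (tau x).
  move=> xb; have [g0 gE] := HG (S x) (Sge x xb).
  have := ES x xb; rewrite -{1 2}gE -(S0_energy g0) -/(tau x).
  have := S1pos x xb; have := dS0_ge0 g0; rewrite -/(tau x).
  set A := S1 x; set B := s' _; move=> B0 A0.
  have L0 : 0 <= lam * B by rewrite mulr_ge0// ltW.
  rewrite -exprMn -mulrA; move: L0; set L := lam * B; move=> L0 H; clearbody L.
  have : A <= (1 + k) * L.
    rewrite -(ler_pXn2r (n := 2))// ?nnegrE ?mulr_ge0// ?addr_ge0//.
    by move: H; rewrite ler_norml => /andP[H1 H2]; nra.
  have : (1 - k) * L <= A.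
    rewrite -(ler_pXn2r (n := 2))// ?nnegrE ?mulr_ge0// ?subr_ge0//.
    by move: H; rewrite ler_norml => /andP[H1 H2]; nra.
  by move=> H1 H2; rewrite ler_norml; apply/andP; split; lra.
have dtau x : 0 < x <= b -> is_derive x 1 tau ((s' (tau x))^-1 * S1 x).
  move=> /andP[x0 xb]; have Sx : 0 < S x by apply: Spos; rewrite x0.
  have [g0 gE] := HG (S x) (ltW Sx).
  have gp : 0 < tau x by exact: Gpos.
  apply: (der_comp (f := G)); last by apply: dS; rewrite (ltW x0).
  rewrite -{1}gE -/(tau x); apply: is_derive_inverse.
  - by near=> y; apply: GK; apply: ltW; near: y; exact: lt_nbhsr.
  - by near=> y; exact: der_cont (der_S0 y).
  - exact: der_S0.
  - by rewrite gt_eqF// dS0_gt0.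
have tauE x : 0 <= x <= b -> `|tau x - lam * x| <= k * lam * x.
  move=> /andP[x0 xb]; apply/ler_addgt0Pr => e e0.
  move: x0; rewrite le_eqVlt => /predU1P[<-|x0].
    by rewrite /tau S00 -{1}S0_0 GK// !mulr0 subrr normr0 add0r ltW.
  pose M := 2 * (lam * mubar m).
  have M0 : 0 < M by rewrite mulr_gt0// mulr_gt0// mubar_gt0.
  have S1M y : 0 <= y <= b -> S1 y <= M.
    move=> yb; have [g0 _] := HG (S y) (Sge y yb).
    have := rE y yb; rewrite ler_norml => /andP[_].
    have := dS0_le_mubar (tau y); have := dS0_ge0 g0; rewrite -/(tau y) => B0 Bm.
    have : lam * s' (tau y) <= lam * mubar m by rewrite ler_pM2l.
    have : 0 <= lam * s' (tau y) by rewrite mulr_ge0// ltW.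
    by rewrite /M -mulrA; nra.
  pose d := e / 2.
  have d0 : 0 < d by rewrite divr_gt0.
  (* The second entry keeps [lam * x1] below [d]; the third keeps [S x1] below [S0 d], hence
     [tau x1] below [d]. So the initial discrepancy at [x1] is at most [e]. *)
  pose x1 := Num.min x (Num.min (d / lam) (S0 d / (2 * M))).
  have [x10 x1x x1l x1S] : [/\ 0 < x1, x1 <= x, x1 <= d / lam & x1 <= S0 d / (2 * M)].
    split; rewrite /x1 ?lt_min ?ge_min ?lexx ?orbT//.
    by rewrite x0 (divr_gt0 d0 lam0); apply: divr_gt0; [exact: S0_gt0|exact: mulr_gt0].
  have x1b : 0 <= x1 <= b by rewrite ltW//= (le_trans x1x).
  have Sx1 : S x1 < S0 d.
    have : S x1 - S 0 <= M * (x1 - 0).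
      have x1b' : x1 <= b by case/andP: x1b.
      apply: (@le_incr_cst _ S S1 0 x1 M (ltW x10)) => y /andP[y0 yx].
        by apply: dS; rewrite y0 (le_trans yx).
      by apply: S1M; rewrite (ltW y0)/= (le_trans (ltW yx)).
    rewrite S00 !subr0 => H; apply: (le_lt_trans H); move: x1S.
    have M2 : 0 < 2 * M by exact: mulr_gt0.
    rewrite ler_pdivlMr// => x1S; have Sd := S0_gt0 d0; clearbody x1 M d; nra.
  have t1 : tau x1 < d.
    have [g0 gE] := HG (S x1) (Sge x1 x1b); rewrite ltNge; apply/negP => dt.
    by have := S0_le (ltW d0) dt; rewrite /tau gE leNgt Sx1.
  have t10 : 0 <= tau x1 by case: (HG (S x1) (Sge x1 x1b)).
  have lx1 : lam * x1 <= d by move: x1l; rewrite ler_pdivlMr// mulrC.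
  have lx10 : 0 <= lam * x1 by rewrite mulr_ge0// ltW.
  have : `|(tau x - lam * x) - (tau x1 - lam * x1)| <= k * lam * x - k * lam * x1.
    apply: (@le_incr_norm _ (fun y => tau y - lam * y) (fun y => k * lam * y)
      (fun y => (s' (tau y))^-1 * S1 y - lam) (fun=> k * lam) x1 x x1x).
    - move=> y /andP[y1 yx]; apply: (der_conv (der_add (dtau y _) (der_opp (der_mul (der_cst lam y) (der_id y))))).
        by rewrite (lt_le_trans x10)//= (le_trans yx).
      by ring.
    - by move=> y _; apply: (der_conv (der_mul (der_cst _ y) (der_id y))); ring.
    - move=> y /andP[y1 yx].
      have y0 : 0 < y by exact: lt_trans y1.
      have yb : y <= b by rewrite (le_trans (ltW yx)).
      have B0 : 0 < s' (tau y) by apply/dS0_gt0/Gpos/Spos; rewrite y0.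
      have := rE y; rewrite (ltW y0) yb => /(_ isT) H.
      rewrite -(ler_pM2r B0); apply: le_trans H.
      by rewrite -{2}(gtr0_norm B0) -normrM mulrBl mulrAC mulVf ?gt_eqF// mul1r.
  move=> H; have kl : 0 <= k * lam by rewrite mulr_ge0// ltW.
  have kx : 0 <= k * lam * x1 by rewrite mulr_ge0// ltW.
  have : `|tau x1 - lam * x1| <= e.
    by rewrite ler_norml; apply/andP; split; move: lx1 t1; rewrite /d; lra.
  have := ler_normD ((tau x - lam * x) - (tau x1 - lam * x1)) (tau x1 - lam * x1).
  by rewrite subrK; lra.
exists tau => x xb; split; [|by rewrite /tau (HG _ (Sge x xb)).2|exact: tauE|exact: rE].
by case: (HG (S x) (Sge x xb)).
Unshelve. all: by end_near. Qed.

End S0theory.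

Section S0even.
Context {K : realType}.
Variables (m : K) (S0 : K -> K).
Hypotheses (m1 : 1 < m) (hS : is_S0 m S0).
Local Notation s' := (derive1 S0).

(* [time_change] with no error term says that two solutions agree on [0, +oo[;
   it is applied to [S0] and its reflection. *)
Lemma dS0_N t : s' (- t) = - s' t /\ S0 (- t) = S0 t.
Proof.
pose T (x : K) := S0 (- x).
have dT (x : K) : is_derive x 1 T (- s' (- x)).
  by apply: (der_conv (der_comp (der_S0 hS (- x)) (der_opp (der_id x)))); rewrite mulrN1.
have dTE : derive1 T = fun x => - s' (- x).
  by apply/funext => x; case: (dT x) => _ <-; rewrite derive1E.
have ddT (x : K) : is_derive x 1 (derive1 T) (s2 m S0 (- x)).
  by rewrite dTE; apply: (der_conv (der_opp (der_comp (der_dS0 hS (- x)) (der_opp (der_id x))))); ring.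
have hT : is_S0 m T.
  split=> [x|x|x||].
  - by split; [case: (dT x)|case: (ddT x)].
  - exact: S0_pos hS _.
  - by have [_] := ddT x; rewrite -derive1E /s2 => <-.
  - by rewrite /T oppr0 (S0_0 hS).
  - by rewrite dTE oppr0 (dS0_0 hS) oppr0.
have key x : 0 <= x -> s' (- x) = - s' x /\ S0 (- x) = S0 x.
  move=> x0.
  have [|||||||tau Htau] := @time_change K m S0 m1 hS T (derive1 T) x 1 0.
  - by [].
  - by rewrite lexx ler01.
  - by rewrite /T oppr0 (S0_0 hS).
  - by move=> y _; exact: der_S0 hT y.
  - by move=> y /andP[y0 _]; exact: S0_gt0 m1 hT _ y0.
  - by move=> y /andP[y0 _]; exact: dS0_ge0 m1 hT _ y0.
  - by move=> y /andP[y0 _]; rewrite mul0r expr1n mul1r (S0_energy m1 hT y0) subrr normr0.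
  - have [|_ E] := Htau x; first by rewrite x0 lexx.
    rewrite !mul0r !mul1r !normr_le0 !subr_eq0 => /eqP tE /eqP E1.
    move: E E1; rewrite tE dTE /T => -> <-; by rewrite opprK.
have [/key//|/ltW] := leP 0 t.
rewrite -oppr_ge0 => /key; rewrite opprK => -[-> ->]; by rewrite opprK.
Qed.

End S0even.

(** * Estimates for a single wave *)

Section wave.
Context {K : realType}.
Variable m : K.
Hypothesis m1 : 1 < m.
Implicit Types (x y t : K).
Local Notation mu := (@lebesgue_measure K).
Local Notation half := (2^-1 : K).

Let m0 : 0 < m. Proof. exact: lt_trans m1. Qed.
Let m10 : 0 < m + 1. Proof. exact: addr_gt0. Qed.

(* [PV], [PF] and [Q] are the antiderivatives vanishing at [0] of [V], [Phi' (R)]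
   and [V ^ 2]; they replace the integrals in the definition of a wave. *)
Record wave (V R : K -> K) (sigma : K) (PV PF Q : K -> K) : Prop := Wave {
  w_dPV : forall x, is_derive x 1 PV (V x);
  w_PV0 : PV 0 = 0;
  w_dPF : forall x, is_derive x 1 PF (force m (R x));
  w_PF0 : PF 0 = 0;
  w_dQ : forall x, is_derive x 1 Q (V x ^+ 2);
  w_Q0 : Q 0 = 0;
  w_R : forall x, R x = PV (x + half) - PV (x - half);
  w_V : forall x, sigma * V x = PF (x + half) - PF (x - half);
  w_Vev : forall x, V (- x) = V x;
  w_Rev : forall x, R (- x) = R x;
  w_V0 : forall x, 0 <= V x;
  w_R0 : forall x, 0 <= R x;
  w_R1 : forall x, R x < 1;
  w_Vmono : forall x y, 0 <= x -> x <= y -> V y <= V x;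
  w_Rmono : forall x y, 0 <= x -> x <= y -> R y <= R x;
  w_s0 : 0 < sigma;
  w_Qle : forall x, 0 <= x -> Q x <= 2^-1 }.

(** The bound on the force outside [[-1/2, 1/2]], where [R <= 3 / 4]. *)
Definition far_force : K := force m (3 / 4).
(** In the equation for [D], the constant [-1] inside [force] contributes [2 / (m + 1)], and the two
    neighbours at distance one contribute [far_force] each. *)
Definition rest_bound : K := 2 / (m + 1) + 2 * far_force.

Lemma far_force_ge0 : 0 <= far_force.
Proof. by apply: force_ge0 => //; lra. Qed.

Lemma rest_bound_gt0 : 0 < rest_bound.
Proof.
have := far_force_ge0; have : 0 < 2 / (m + 1) by rewrite divr_gt0.
by rewrite /rest_bound; lra.
Qed.

Section facts.
Variables (V R : K -> K) (sigma : K) (PV PF Q : K -> K).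
Hypothesis w : wave V R sigma PV PF Q.
Local Notation D x := (1 - R x).
Local Notation eps := (1 - R 0).

Lemma PV_odd x : PV (- x) = - PV x.
Proof. exact: antider_odd (w_PV0 w) (w_dPV w) (w_Vev w) x. Qed.

Lemma PF_odd x : PF (- x) = - PF x.
Proof.
by apply: antider_odd (w_PF0 w) (w_dPF w) _ x => y; rewrite (w_Rev w).
Qed.

Lemma dshift (f f' : K -> K) x c : (forall x, is_derive x 1 f (f' x)) ->
  is_derive x 1 (fun y : K => f (y + c)) (f' (x + c)).
Proof.
move=> df; apply: (der_conv (@der_comp _ f (fun y => y + c) _ _ _ (df (x + c)) (der_add (der_id x) (der_cst c x)))).
by rewrite addr0 mulr1.
Qed.

Lemma der_R x : is_derive x 1 R (V (x + half) - V (x - half)).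
Proof.
have -> : R = fun x => PV (x + half) - PV (x - half) by apply/funext => y; exact: w_R w y.
exact: der_add (dshift _ _ (w_dPV w)) (der_opp (dshift _ _ (w_dPV w))).
Qed.

Lemma der_V x : is_derive x 1 V
  (sigma^-1 * (force m (R (x + half)) - force m (R (x - half)))).
Proof.
have -> : V = fun x => sigma^-1 * (PF (x + half) - PF (x - half)).
  by apply/funext => y; rewrite -(w_V w) mulKf// gt_eqF// (w_s0 w).
apply: (der_conv (der_mul (der_cst _ x) (der_add (dshift _ _ (w_dPF w)) (der_opp (dshift _ _ (w_dPF w)))))).
by rewrite mul0r add0r.
Qed.

Definition D1 x : K := V (x - half) - V (x + half).

Lemma der_D x : is_derive x 1 (fun y => D y) (D1 x).
Proof. by apply: (der_conv (der_add (der_cst 1 x) (der_opp (der_R x)))); rewrite add0r opprB. Qed.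

Lemma der_D1 x : is_derive x 1 D1
  (sigma^-1 * (2 * force m (R x) - force m (R (x - 1)) - force m (R (x + 1)))).
Proof.
apply: (der_conv (der_add (dshift _ _ der_V) (der_opp (dshift _ _ der_V)))).
rewrite subrK addrK (_ : x - half - half = x - 1); last by field.
rewrite (_ : x + half + half = x + 1); last by field.
by ring.
Qed.

(* Cauchy-Schwarz on [0, 1], in the form [int_0^1 (V - r) ^ 2 >= 0] with
   [r = R (1/2) = int_0^1 V]. *)
Lemma R_half_le : R half <= 3 / 4.
Proof.
pose r := R half.
have rE : r = PV 1.
  by rewrite /r (w_R w) subrr (w_PV0 w) subr0; congr PV; field.
have d x : is_derive x 1 (fun y => Q y - 2 * r * PV y + r ^+ 2 * y) ((V x - r) ^+ 2).
  apply: (der_conv (der_add (der_add (w_dQ w x) (der_opp (der_mul (der_cst (2 * r) x) (w_dPV w x)))) (der_mul (der_cst (r ^+ 2) x) (der_id x)))).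
  by ring.
have := @ge_incr_cst _ _ _ 0 1 0 ler01 (fun x _ => d x) (fun x _ => sqr_ge0 _).
rewrite (w_PV0 w) (w_Q0 w) -rE; have := w_Qle w ler01; have : 0 <= r by exact: w_R0 w _.
by rewrite -/r => ? ? ?; nra.
Qed.

Lemma R_far x : half <= `|x| -> R x <= 3 / 4.
Proof.
have H y : half <= y -> R y <= 3 / 4.
  by move=> hy; apply: le_trans R_half_le; apply: w_Rmono w _ _ _ hy; rewrite invr_ge0.
by case: (ler0P x) => _ /H //; rewrite (w_Rev w).
Qed.

Lemma force_far x : half <= `|x| -> 0 <= force m (R x) <= far_force.
Proof.
move=> hx; rewrite force_ge0 ?(w_R0 w) ?(w_R1 w)//=.
by apply: force_mono => //; [exact: R_far|lra].
Qed.

(** On [[0, 1/2]], [V] is at least [V (1/2)], and the integral of [V ^ 2] there is at most [1/2]. *)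
Lemma V_half_le : V half <= 1.
Proof.
have h0 : 0 <= half by rewrite invr_ge0.
have := @ge_incr_cst _ Q _ 0 half (V half ^+ 2) h0 (fun x _ => w_dQ w x).
rewrite (w_Q0 w) !subr0 => H.
have : V half ^+ 2 * half <= Q half.
  apply: H => x /andP[x0 xh]; rewrite ler_pXn2r// ?nnegrE ?(w_V0 w)//.
  by apply: w_Vmono w _ _ _ _; exact: ltW.
have := w_Qle w h0; have := w_V0 w half; nra.
Qed.

Lemma sV0 : sigma * V 0 = 2 * PF half.
Proof. by rewrite (w_V w) add0r sub0r PF_odd; ring. Qed.

Lemma PF_mono x y : x <= y -> PF x <= PF y.
Proof.
move=> xy; rewrite -subr_ge0; have := @ge_incr_cst _ PF _ x y 0 xy (fun x _ => w_dPF w x).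
by rewrite mul0r; apply => z _; rewrite force_ge0 ?(w_R0 w) ?(w_R1 w).
Qed.

(** [sigma * V 0] is twice the force integrated over [[0, 1/2]], while [sigma * V (1/2)] is the
    force integrated over [[0, 1]]; hence [V 0 <= 2 * V (1/2)]. *)
Lemma V0_le : V 0 <= 2.
Proof.
have := V_half_le; have s0 := w_s0 w; have := sV0; have := w_V w half.
rewrite subrr (w_PF0 w) subr0 (_ : half + half = 1); last by field.
have : PF half <= PF 1 by apply: PF_mono; lra.
move=> h1 h2 h3 h4; rewrite -(ler_pM2l s0); nra.
Qed.

Lemma V0_ge : 1 - eps <= V 0.
Proof.
rewrite subKr (w_R w) add0r sub0r PV_odd opprK.
have h0 : 0 <= half by rewrite invr_ge0.
have := @le_incr_cst _ PV _ 0 half (V 0) h0 (fun x _ => w_dPV w x).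
rewrite (w_PV0 w) !subr0 => H.
have : PV half <= V 0 * half.
  by apply: H => x /andP[x0 _]; apply: w_Vmono w _ _ _ _; rewrite ?lexx// ltW.
lra.
Qed.

Lemma V_le2 x : V x <= 2.
Proof.
apply: le_trans V0_le; have [x0|x0] := leP 0 x; first exact: w_Vmono w _ _ _ _.
by rewrite -(w_Vev w); apply: w_Vmono w _ _ _ _ => //; lra.
Qed.

(** After multiplication by [sigma], the large force near the crest cancels: the quantity becomes
    [PF (1 - y) + PF (1 + y) - 2 * PF (1/2)], in which only the force beyond [1/2] is integrated. *)
Lemma V_sum y : 0 <= y <= half ->
  `|V (half - y) + V (half + y) - V 0| <= 2 * far_force / sigma.
Proof.
move=> /andP[y0 yh]; have s0 := w_s0 w.
rewrite ler_pdivlMr// -[X in _ * X <= _](gtr0_norm s0) -normrM mulrC mulrBr mulrDr sV0 !(w_V w).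
have -> : half - y + half = 1 - y by field.
have -> : half - y - half = - y by field.
have -> : half + y + half = 1 + y by field.
have -> : half + y - half = y by field.
rewrite PF_odd.
have H x z : half <= x -> x <= z -> 0 <= PF z - PF x <= far_force * (z - x).
  move=> hx xz; rewrite subr_ge0 PF_mono//=.
  apply: le_incr_cst xz (fun u _ => w_dPF w u) _ => u /andP[xu _].
  have u0 : half <= `|u|.
    by apply: le_trans (ler_norm u); exact: le_trans hx (ltW xu).
  by case/andP: (force_far u0).
have := H half (1 - y); have := H half (1 + y).
rewrite lexx => /(_ isT); rewrite (_ : half <= 1 + y); last by lra.
move=> /(_ isT) /andP[h1 h2]; rewrite (_ : half <= 1 - y); last by lra.
move=> /(_ isT isT) /andP[h3 h4]; have f0 := far_force_ge0.
rewrite ger0_norm; last by lra.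
by nra.
Qed.

Lemma R_le_V x : half <= x -> R x <= V (x - half).
Proof.
move=> hx; rewrite (w_R w).
have xx : x - half <= x + half by lra.
have := @le_incr_cst _ PV _ _ _ (V (x - half)) xx (fun x _ => w_dPV w x).
rewrite (_ : x + half - (x - half) = 1); last by field.
rewrite mulr1; apply => z /andP[xz _].
by apply: w_Vmono w _ _ _ _; [lra|exact: ltW].
Qed.

(** [sigma * V (x + 1)] averages the force over [[x + 1/2, x + 3/2]], so it is at most the force at
    [x + 1/2]. That is linear in [R (x + 1/2)], itself an average of [V] over [[x, x + 1]]. *)
Lemma V_decay x : 0 <= x -> V (x + 1) <= linear_force_bound m / sigma * V x.
Proof.
move=> x0; have s0 := w_s0 w.
rewrite mulrAC ler_pdivlMr// mulrC (w_V w).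
have -> : x + 1 + half = x + half + 1 by ring.
have -> : x + 1 - half = x + half by field.
have xx : x + half <= x + half + 1 by lra.
have hx : half <= `|x + half| by rewrite ger0_norm; lra.
have := @le_incr_cst _ PF _ _ _ (force m (R (x + half))) xx (fun x _ => w_dPF w x).
rewrite (_ : x + half + 1 - (x + half) = 1); last by ring.
rewrite mulr1 => H; apply: (@le_trans _ _ (force m (R (x + half)))).
  apply: H => z /andP[xz _]; apply: force_mono => //; last exact: w_R1 w _.
  by apply: w_Rmono w _ _ _ _; [lra|exact: ltW].
apply: le_trans (force_linear m1 (w_R0 w _) (R_far hx)) _.
rewrite ler_pM2l ?linear_force_bound_gt0//.
have hx2 : half <= x + half by lra.
by have := R_le_V hx2; rewrite addrK.
Qed.

Lemma V1_le : V 1 <= far_force / sigma.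
Proof.
have s0 := w_s0 w; rewrite ler_pdivlMr// mulrC (w_V w).
have -> : 1 - half = half by field.
have xx : half <= 1 + half by lra.
have := @le_incr_cst _ PF _ _ _ far_force xx (fun x _ => w_dPF w x).
rewrite addrK mulr1; apply => z /andP[xz _].
have hz : half <= `|z| by apply: le_trans (ltW xz) (ler_norm z).
by case/andP: (force_far hz).
Qed.

Lemma Phi_R_cont : continuous (fun x => Phi m (R x)).
Proof.
by move=> x; apply: (der_cont (der_comp (der_Phi m1 (w_R1 w x)) (der_R x))).
Qed.

(** Both bounds share the tail: beyond [1/2], [Phi (R) <= R * Phi' (R) <= linear_force_bound * R ^
    2] and [R x <= V (x - 1/2)], so the norm of [V] controls it. The central part is bounded once by
    the integrated force, which is [sigma * V 0 / 2] on a half, and once by [eps ^ -m]. Diverging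
    energy thus drives [sigma] to infinity and [eps] to zero. *)
Lemma energy_le : (\int[mu]_x (Phi m (R x))%:E <= (2 * sigma + 2 * linear_force_bound m)%:E)%E /\
  (\int[mu]_x (Phi m (R x))%:E <= (eps `^ (- m) + 2 * linear_force_bound m)%:E)%E.
Proof.
have L0 := linear_force_bound_gt0 m; set L := linear_force_bound m in L0 *.
have [P P0 aP] := antider_ex Phi_R_cont.
have h0 : 0 <= half by rewrite invr_ge0.
have Pge x : 0 <= x -> 0 <= P x.
  move=> x0; have := @ge_incr_cst _ P _ 0 x 0 x0 (fun x _ => aP.1 x).
  by rewrite P0 mul0r subr0; apply => z _; apply: Phi_ge0 => //; [exact: w_R0 w _|exact: w_R1 w _].
have B1 : P half <= eps `^ (- m) * half.
  have := @le_incr_cst _ P _ 0 half (eps `^ (- m)) h0 (fun x _ => aP.1 x).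
  rewrite P0 !subr0; apply => x /andP[x0 _].
  apply: (@le_trans _ _ (Phi m (R 0))).
    by apply: Phi_mono => //; [exact: w_R0 w _|apply: w_Rmono w _ _ _ _; rewrite ?lexx ?ltW|exact: w_R1 w _].
  by apply: Phi_le_pow => //; [exact: w_R0 w _|exact: w_R1 w _].
have B2 : P half <= sigma.
  have : P half - P 0 <= PF half - PF 0.
    apply: le_incr h0 (fun x _ => aP.1 x) (fun x _ => w_dPF w x) _ => x _.
    apply: le_trans (Phi_le m1 (w_R0 w x) (w_R1 w x)) _.
    have := force_ge0 m1 (w_R0 w x) (w_R1 w x); have := w_R0 w x; have := w_R1 w x; nra.
  rewrite P0 (w_PF0 w) !subr0; have := sV0; have := V0_le; have := w_s0 w; nra.
have T (n : nat) : P n%:R - P 0 <= P half + L.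
  rewrite P0 subr0; case: n => [|n].
    by rewrite P0 addr_ge0 ?Pge// ltW.
  have hn : half <= n.+1%:R.
    by apply: (@le_trans _ _ 1); [lra|rewrite ler1n].
  have : P n.+1%:R - P half <= L * Q (n.+1%:R - half) - L * Q (half - half).
    apply: (@le_incr _ P (fun y => L * Q (y - half)) _ (fun y => L * V (y - half) ^+ 2) _ _ hn (fun x _ => aP.1 x)).
      by move=> x _; apply: (der_conv (der_mul (der_cst L x) (dshift _ _ (w_dQ w)))); ring.
    move=> x /andP[hx _]; apply: le_trans (Phi_le m1 (w_R0 w x) (w_R1 w x)) _.
    have hx' : half <= `|x| by exact: le_trans (ltW hx) (ler_norm x).
    have := force_linear m1 (w_R0 w _) (R_far hx'); rewrite -/L.
    have := R_le_V (ltW hx); have := w_R0 w x; move: (R x) (V _) (force _ _) => r v f *.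
    have ? : r * r <= v * v by nra.
    nra.
  have : Q (n.+1%:R - half) <= 2^-1 by apply: w_Qle w _ _; lra.
  rewrite subrr (w_Q0 w) mulr0; nra.
have I B : (forall n : nat, P n%:R - P 0 <= B) -> (\int[mu]_x (Phi m (R x))%:E <= (2 * B)%:E)%E.
  apply: even_integral_le => //; last exact: Phi_R_cont.
  - by move=> x; apply: Phi_ge0 => //; [exact: w_R0 w _|exact: w_R1 w _].
  - by move=> x; rewrite (w_Rev w).
split.
  rewrite -mulrDr; apply: I => n; apply: le_trans (T n) _; by rewrite lerD2r.
have -> : eps `^ (- m) + 2 * L = 2 * (eps `^ (- m) * half + L) by field.
by apply: I => n; apply: le_trans (T n) _; rewrite lerD2r.
Qed.

Lemma eps_gt0 : 0 < eps. Proof. by rewrite subr_gt0; exact: w_R1 w 0. Qed.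

Lemma D_gt0 x : 0 < D x. Proof. by rewrite subr_gt0; exact: w_R1 w x. Qed.

Lemma D_le1 x : D x <= 1. Proof. by rewrite lerBlDr lerDl; exact: w_R0 w x. Qed.

Lemma D_mono x y : 0 <= x -> x <= y -> D x <= D y.
Proof. by move=> x0 xy; rewrite lerB//; exact: w_Rmono w _ _ x0 xy. Qed.

Lemma D1E x : D1 x = V (half - x) - V (half + x).
Proof. by rewrite /D1 -(w_Vev w (x - half)) opprB (addrC x). Qed.

Lemma D1_ge0 y : 0 <= y <= half -> 0 <= D1 y.
Proof.
move=> /andP[y0 yh]; rewrite D1E subr_ge0; apply: w_Vmono w _ _ _ _; lra.
Qed.

Lemma D1_0 : D1 0 = 0.
Proof. by rewrite D1E subr0 addr0 subrr. Qed.

Definition D2 x : K := sigma^-1 * (2 * force m (R x) - force m (R (x - 1)) - force m (R (x + 1))).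

Lemma D2_approx y : 0 <= y <= half ->
  `|sigma * D2 y - 2 / (m + 1) * D y `^ (- (m + 1))| <= rest_bound.
Proof.
move=> /andP[y0 yh]; rewrite /D2 mulVKf ?gt_eqF ?(w_s0 w)//.
have h1 : half <= `|y - 1| by rewrite ler0_norm; lra.
have h2 : half <= `|y + 1| by rewrite ger0_norm; lra.
have /andP[a1 a2] := force_far h1; have /andP[b1 b2] := force_far h2.
rewrite {1}/force /rest_bound; have mm : 0 < 2 / (m + 1) by rewrite divr_gt0.
move: (D y `^ _) => p; rewrite (_ : 2 * ((m + 1)^-1 * (p - 1)) = 2 / (m + 1) * p - 2 / (m + 1)); last by ring.
by rewrite ler_norml; apply/andP; split; lra.
Qed.

(** The left side is the variation, from [0] to [y], of the energy of the unperturbed equation. Its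
    derivative is [2 * D1] times the rest in [D2_approx]; as [D1 >= 0], the bound integrates to a
    multiple of [D y - eps], which vanishes at the crest. *)
Lemma wave_energy y : 0 <= y <= half ->
  `|sigma * D1 y ^+ 2 - mubar m ^+ 2 * (eps `^ (- m) - D y `^ (- m))|
  <= 2 * rest_bound * (D y - eps).
Proof.
move=> /andP[y0 yh].
pose f x := sigma * D1 x ^+ 2 + mubar m ^+ 2 * D x `^ (- m).
have df x : is_derive x 1 f (2 * D1 x * (sigma * D2 x - 2 / (m + 1) * D x `^ (- (m + 1)))).
  apply: (der_conv (der_add (der_mul (der_cst sigma x) (der_exp 1 (der_D1 x))) (der_mul (der_cst _ x) (der_powR (- m) (der_D x) (D_gt0 x))))).
  rewrite mubar2// (_ : - m - 1 = - (m + 1)); last by ring.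
  by rewrite -/(D2 x) expr1; field; rewrite (gt_eqF m0) (gt_eqF m10).
have := @le_incr_norm _ f (fun x => 2 * rest_bound * D x) _ (fun x => 2 * rest_bound * D1 x) 0 y y0 (fun x _ => df x).
rewrite {1 2}/f D1_0 expr0n mulr0 add0r /= => H.
rewrite (_ : sigma * _ - _ = sigma * D1 y ^+ 2 + mubar m ^+ 2 * D y `^ (- m) -
  mubar m ^+ 2 * eps `^ (- m)); last by ring.
rewrite mulrBr; apply: H => x.
  by move=> _; apply: (der_conv (der_mul (der_cst _ x) (der_D x))); ring.
move=> /andP[x0 xy]; have xh : 0 <= x <= half by rewrite ltW//= (le_trans (ltW xy)).
have := D1_ge0 xh; have := D2_approx xh.
rewrite normrM => h1 h2; rewrite ger0_norm ?mulr_ge0//.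
by rewrite [leRHS]mulrAC; apply: ler_wpM2l => //; exact: mulr_ge0.
Qed.

(** Weak monotonicity allows a flat crest, but [time_change] wants [0 < S x]. On a flat piece [D2]
    would be positive by the largeness of [eps ^ -(m + 1)], which is a contradiction. *)
Lemma D_gt_eps y : rest_bound < 2 / (m + 1) * eps `^ (- (m + 1)) -> 0 < y <= half -> eps < D y.
Proof.
move=> big /andP[y0 yh].
have [//|Dle] := ltP eps (D y).
have Deq x : 0 <= x -> x <= y -> D x = eps.
  move=> x0 xy; apply/eqP; rewrite eq_le (D_mono _ x0)// andbT.
  exact: le_trans (D_mono x0 xy) Dle.
have D2pos x : 0 <= x -> x <= y -> 0 < D2 x.
  move=> x0 xy; have xh : 0 <= x <= half by rewrite x0 (le_trans xy).
  have := D2_approx xh; rewrite Deq// ler_norml => /andP[h _].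
  by rewrite -(pmulr_rgt0 _ (w_s0 w)); lra.
have D1pos x : 0 < x -> x <= y -> 0 < D1 x.
  move=> x0 xy; have [z /andP[z0 zx]] := MVTc x0 (fun x _ => der_D1 x).
  rewrite D1_0 !subr0 => ->; rewrite mulr_gt0//; apply: D2pos; first exact: ltW.
  by rewrite (le_trans (ltW zx)).
have [z /andP[z0 zy]] := MVTc y0 (fun x _ => der_D x).
rewrite (Deq y)//; last exact: ltW.
rewrite subrr subr0 => /esym/eqP; rewrite mulf_eq0 (gt_eqF y0) orbF gt_eqF//.
by apply: D1pos => //; exact: ltW.
Qed.

Lemma D1_half : D1 half = V 0 - V 1.
Proof. by rewrite D1E subrr; congr (_ - V _); field. Qed.

(** [R (1/2)] is the integral of [V] over [[0, 1]]; folding that interval at [1/2] reduces it to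
    [V_sum]. *)
Lemma R_half_V0 : `|R half - V 0 / 2| <= far_force / sigma.
Proof.
have h0 : 0 <= half by rewrite invr_ge0.
pose M := 2 * far_force / sigma.
pose f y := PV (half + y) - PV (half - y) - V 0 * y.
have d y : is_derive y 1 f (V (half - y) + V (half + y) - V 0).
  have d1 : is_derive y 1 (fun z : K => half + z) 1.
    by apply: (der_conv (der_add (der_cst half y) (der_id y))); rewrite add0r.
  have d2 : is_derive y 1 (fun z : K => half - z) (-1).
    by apply: (der_conv (der_add (der_cst half y) (der_opp (der_id y)))); rewrite add0r.
  apply: (der_conv (der_add (der_add (@der_comp _ PV _ _ _ _ (w_dPV w _) d1) (der_opp (@der_comp _ PV _ _ _ _ (w_dPV w _) d2)))
    (der_opp (der_mul (der_cst (V 0) y) (der_id y))))).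
  by ring.
have := @le_incr_norm _ f (fun y => M * y) _ (fun=> M) 0 half h0 (fun y _ => d y).
have -> : f half - f 0 = R half - V 0 / 2.
  rewrite /f (w_R w) (_ : half - half = 0) ?subrr// (w_PV0 w) addr0 subr0.
  by rewrite (_ : half - 0 = half) ?subr0//; ring.
have -> : M * half - M * 0 = far_force / sigma by rewrite /M; field; rewrite gt_eqF// (w_s0 w).
apply=> [y _|y /andP[y0 yh]].
  by apply: (der_conv (der_mul (der_cst M y) (der_id y))); ring.
by apply: V_sum; rewrite !ltW.
Qed.

(** For large [sigma] the factor in [V_decay] is below the [1 / 4] required by [bump_decay], applied
    from [1] onwards; moving the weight back by one unit costs another factor [4]. *)
Lemma V_tail x : linear_force_bound m / sigma <= 4^-1 -> 1 <= x -> V x <= 8 * V 1 * bump x.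
Proof.
move=> sl x1; have V10 := w_V0 w 1.
have := @bump_decay K (fun y => V (1 + y)) (V 1) (x - 1).
rewrite subrKC => H; have x10 : 0 <= x - 1 by lra.
apply: le_trans (H _ _ V10 x10) _.
- by move=> y /andP[y0 _]; apply: w_Vmono w _ _ _ _ => //; lra.
- move=> y y0; rewrite addrA.
  have y1 : 0 <= 1 + y by lra.
  apply: le_trans (V_decay y1) _; rewrite mulrC.
  by rewrite ler_wpM2l// (w_V0 w).
have -> : 8 * V 1 * bump x = 2 * V 1 * (4 * bump x) by ring.
rewrite ler_wpM2l ?mulr_ge0// /bump -[4]invrK -invfM lef_pV2 ?posrE; last 2 first.
- by rewrite ltr_wpDr ?sqr_ge0.
- by rewrite mulr_gt0// ?invr_gt0// ltr_wpDr ?sqr_ge0.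
by have := sqr_ge0 (3 * x - 4); nra.
Qed.

Lemma R_tail x : linear_force_bound m / sigma <= 4^-1 -> 3 / 2 <= x -> R x <= 32 * V 1 * bump x.
Proof.
move=> sl x1; have V10 := w_V0 w 1; have hx : half <= x by lra.
have hx1 : 1 <= x - half by lra.
apply: le_trans (R_le_V hx) _; apply: le_trans (V_tail sl hx1) _.
have -> : 32 * V 1 * bump x = 8 * V 1 * (4 * bump x) by ring.
rewrite ler_wpM2l ?mulr_ge0// /bump -[4]invrK -invfM lef_pV2 ?posrE; last 2 first.
- by rewrite ltr_wpDr ?sqr_ge0.
- by rewrite mulr_gt0// ?invr_gt0// ltr_wpDr ?sqr_ge0.
by have := sqr_ge0 (3 * x - 2); nra.
Qed.

End facts.
End wave.

(** * From solitary waves to the record [wave] *)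

Section wave_of_family.
Context {K : realType}.
Variable m : K.
Hypothesis m1 : 1 < m.
Local Notation mu := (@lebesgue_measure K).

(** Unimodality speaks only of the open half-line; continuity adds the crest. *)
Lemma unimodal_anti (f : K -> K) : continuous f -> unimodal f ->
  forall x y : K, 0 <= x -> x <= y -> f y <= f x.
Proof.
move=> cf [_ uf] x y x0 xy.
have pos u v : 0 < u -> u <= v -> f v <= f u.
  move=> u0 uv; apply: uf => //; rewrite in_itv/= andbT//.
  exact: lt_le_trans uv.
move: x0; rewrite le_eqVlt => /predU1P[x0|x0]; last exact: pos.
rewrite -x0 in xy *; move: xy; rewrite le_eqVlt => /predU1P[<-//|y0].
rewrite leNgt; apply/negP => fy.
have cv : f z @[z --> 0^'+] --> f 0 by apply: cvg_at_right_filter; exact: cf.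
have [z [z0 zy fz]] : exists z, [/\ 0 < z, z < y & f z < f y].
  near (0:K)^'+ => z; exists z; split.
  - by near: z; exact: nbhs_right_gt.
  - by near: z; exact: nbhs_right_lt.
  - by near: z; exact: cvgr_lt cv _ fy.
by have := pos _ _ z0 (ltW zy); rewrite leNgt fz.
Unshelve. all: by end_near. Qed.

Lemma BC1_cont (f : K -> K) : BC1 f -> continuous f.
Proof. by case=> df _ _ _ x; apply/differentiable_continuous/derivable1_diffP. Qed.

(** The norm of [V] is used in both directions: inside the record it only bounds [Q] above, while
    the last conjunct keeps the converse, needed to compare [eps] with [delta]. *)
Lemma wave_of_profile V R sigma d : solitary_wave m V R sigma -> wave_profile V -> wave_profile R ->
  0 < d < 1 -> (forall x, 0 <= R x < 1) -> ('N[mu]_2%:E[EFin \o V] = (1 - d)%:E)%E ->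
  exists PV PF Q, wave m V R sigma PV PF Q /\
    (forall B, (forall n : nat, Q n%:R <= B) -> (1 - d) ^+ 2 <= 2 * B).
Proof.
move=> [_ _ s0 RE VE] [_ /BC1_cont cV V0 Vev Vu] [_ /BC1_cont cR _ Rev Ru] /andP[d0 d1] R01 N2.
have R0 x : 0 <= R x by case/andP: (R01 x).
have R1 x : R x < 1 by case/andP: (R01 x).
have [PV PV0 aPV] := antider_ex cV.
have cF : continuous (fun x => force m (R x)).
  move=> x; apply: continuous_comp; first exact: cR.
  exact: der_cont (der_force m1 (R1 x)).
have [PF PF0 aPF] := antider_ex cF.
have cQ : continuous (fun x => V x ^+ 2).
  by move=> x; apply: (@continuous_comp _ _ _ V (fun y => y ^+ 2)); [exact: cV|exact: exprn_continuous].
have [Q Q0 aQ] := antider_ex cQ.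
have IQ : (\int[mu]_x (V x ^+ 2)%:E = ((1 - d) ^+ 2)%:E)%E.
  have n2 : (2 : K) != 0 by rewrite pnatr_eq0.
  have := @poweR_Lnorm _ _ _ mu (EFin \o V) 2 n2.
  rewrite N2 poweR_EFin powR_mulrn ?subr_ge0 ?ltW// => ->.
  by apply: eq_integral => x _ /=; rewrite powR_mulrn// real_normK// num_real.
exists PV, PF, Q; split; last first.
  move=> B QB; rewrite -lee_fin -IQ; apply: even_integral_le aQ _ => //.
  - by move=> x; exact: sqr_ge0.
  - by move=> x; rewrite Vev.
  - by move=> n; rewrite Q0 subr0.
split => //.
- by case: aPV.
- by case: aPF.
- by case: aQ.
- move=> x; rewrite RE /avg /Rintegral aPV.2//; lra.
- move=> x; rewrite VE /avg.
  have -> : (fun y => derive1 (Phi m) (R y)) = (fun y => force m (R y)).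
    by apply/funext => y; rewrite derive1_Phi.
  by rewrite /Rintegral aPF.2//; lra.
- exact: unimodal_anti.
- exact: unimodal_anti.
- move=> x x0.
  have : ((2 * (Q x - Q 0))%:E <= ((1 - d) ^+ 2)%:E)%E.
    rewrite -IQ; apply: even_integral_ge => //; first by move=> y; exact: sqr_ge0.
    by move=> y; rewrite Vev.
  by rewrite lee_fin Q0 subr0; nra.
Qed.

End wave_of_family.

(** * Small amplitude and the size of [sigma] *)

Lemma sqr_half_two (K : realType) (q : K) : 1 / 2 <= q <= 2 -> 1 / 4 <= q ^+ 2 <= 4.
Proof. by move=> /andP[q1 q2]; apply/andP; split; nra. Qed.

Lemma scale_bounds (K : realType) (s u v r : K) : 0 < s -> v <= u / 2 ->
  1 / 4 <= r -> r <= 4 -> s * r - u <= v -> - v <= s * r - u ->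
  u / 8 <= s <= 8 * u.
Proof. by move=> *; apply/andP; split; nra. Qed.

Section family.
Context {K : realType}.
Variables (m : K) (S0 : K -> K) (V R : K -> K -> K) (sigma : K -> K).
Hypotheses (m1 : 1 < m) (hS : is_S0 m S0) (hF : high_energy_family m V R sigma).
Local Notation mu := (@lebesgue_measure K).
Local Notation half := (2^-1 : K).
Local Notation eps := (amplitude R).
Local Notation s' := (derive1 S0).
Local Notation kap := (kappabar S0).
Local Notation mub := (mubar m).

Let m0 : 0 < m. Proof. exact: lt_trans m1. Qed.
Let m10 : 0 < m + 1. Proof. exact: addr_gt0. Qed.

Definition has_wave d := exists PV PF Q, wave m (V d) (R d) (sigma d) PV PF Q.

Lemma near01 : \forall d \near (0:K)^'+, 0 < d < 1.
Proof.
near=> d; apply/andP; split; near: d; [exact: nbhs_right_gt|exact: nbhs_right_lt].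
Unshelve. all: by end_near. Qed.

Lemma wave_data d : 0 < d < 1 -> exists PV PF Q, wave m (V d) (R d) (sigma d) PV PF Q /\
    (forall B, (forall n : nat, Q n%:R <= B) -> (1 - d) ^+ 2 <= 2 * B).
Proof.
move=> d01; apply: wave_of_profile => //.
- exact: hef_wave hF _ d01.
- exact: hef_V hF _ d01.
- exact: hef_R hF _ d01.
- exact: hef_range hF _ d01.
- exact: hef_norm hF _ d01.
Qed.

Lemma has_wave_near : \forall d \near 0^'+, has_wave d.
Proof.
near=> d; have [|PV [PF [Q [w _]]]] := @wave_data d; first by near: d; exact: near01.
by exists PV, PF, Q.
Unshelve. all: by end_near. Qed.

Lemma sigma_large M : \forall d \near 0^'+, M <= sigma d.
Proof.
have /cvgeyPge H := hef_energy hF; near=> d.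
have [PV [PF [Q w]]] : has_wave d by near: d; exact: has_wave_near.
have := (energy_le m1 w).1.
have : ((2 * M + 2 * linear_force_bound m)%:E <= \int[mu]_x (Phi m (R d x))%:E)%E.
  by near: d; exact: H.
by move=> /le_trans h /h; rewrite lee_fin; lra.
Unshelve. all: by end_near. Qed.

Lemma eps_small e : 0 < e -> \forall d \near 0^'+, eps d <= e.
Proof.
move=> e0; have /cvgeyPge H := hef_energy hF; near=> d.
have [PV [PF [Q w]]] : has_wave d by near: d; exact: has_wave_near.
have := (energy_le m1 w).2.
have : ((e `^ (- m) + 1 + 2 * linear_force_bound m)%:E <= \int[mu]_x (Phi m (R d x))%:E)%E.
  by near: d; exact: H.
move=> /le_trans h /h; rewrite lee_fin; move=> h2; rewrite leNgt; apply/negP => h3.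
by have := powRN_le (ltW m0) e0 (ltW h3); rewrite /amplitude in h3 *; lra.
Unshelve. all: by end_near. Qed.

Lemma eps_gt0_near : \forall d \near 0^'+, 0 < eps d.
Proof.
near=> d; have [PV [PF [Q w]]] : has_wave d by near: d; exact: has_wave_near.
exact: eps_gt0 w.
Unshelve. all: by end_near. Qed.

Lemma eps_powm_small e : 0 < e -> \forall d \near 0^'+, eps d `^ m <= e.
Proof.
move=> e0; near=> d.
have d0 : 0 < eps d by near: d; exact: eps_gt0_near.
have d1 : eps d <= 1 by near: d; exact: eps_small.
have de : eps d <= e by near: d; exact: eps_small.
by apply: le_trans de; apply: ge1r_powR; rewrite ?d0 ?d1// ltW.
Unshelve. all: by end_near. Qed.

(** This is [wave_energy] at [1/2], multiplied by [eps ^ m]. There [D'] equals [V 0 - V 1], which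
    lies in [[1/2, 2]], and [D >= 1/4], so all terms but the two leading ones are [O(eps ^ m)]. *)
Lemma sigma_scale : \forall d \near 0^'+,
  mub ^+ 2 / 8 <= sigma d * eps d `^ m <= 8 * mub ^+ 2.
Proof.
have mb := mubar_gt0 m1; have mb2 : 0 < mub ^+ 2 by exact: exprn_gt0.
pose A : K := (4^-1) `^ (- m); pose H := rest_bound m.
have A0 : 0 <= A by exact: powR_ge0.
have H0 : 0 < H by exact: rest_bound_gt0.
pose M := mub ^+ 2 * A + 2 * H.
have M0 : 0 < M by rewrite ltr_wpDl ?mulr_gt0// mulr_ge0// ltW.
near=> d.
have [PV [PF [Q w]]] : has_wave d by near: d; exact: has_wave_near.
have e0 := eps_gt0 w; have s0 := w_s0 w.
have e4 : eps d <= 1 / 4 by near: d; apply: eps_small; lra.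
have em : eps d `^ m <= mub ^+ 2 / 2 / M.
  by near: d; apply: eps_powm_small; rewrite !divr_gt0.
have sl : 4 * far_force m <= sigma d by near: d; exact: sigma_large.
have hh : 0 <= half <= half by rewrite lexx invr_ge0 ler0n.
have := wave_energy m1 w hh; rewrite (D1_half w) -/(eps d) -/H.
have c1 := V0_ge w; have c2 := V0_le m1 w; rewrite -/(eps d) in c1.
have v1 : V d 1 <= 4^-1.
  by apply: le_trans (V1_le m1 w) _; rewrite ler_pdivrMr//; lra.
have v10 := w_V0 w 1.
have Dh : (1 - R d half) `^ (- m) <= A.
  by apply: powRN_le => //; [exact: ltW|have := R_half_le w; lra].
have Dh0 : 0 <= (1 - R d half) `^ (- m) by exact: powR_ge0.
have emE : eps d `^ m * eps d `^ (- m) = 1.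
  by rewrite powRN mulfV// gt_eqF// powR_gt0.
have em0 : 0 < eps d `^ m by exact: powR_gt0.
have D1h : 1 - R d half <= 1 by exact: D_le1 w _.
have : 1 / 2 <= V d 0 - V d 1 <= 2 by apply/andP; split; lra.
move: (V d 0 - V d 1) => q q12.
have {q12}[q1 q2] : 1 / 4 <= q ^+ 2 /\ q ^+ 2 <= 4 by case/sqr_half_two/andP: q12.
move: em; rewrite ler_pdivlMr//; set E := eps d `^ m in emE em0 *; set N := _ `^ (- m) in emE *.
set X := (1 - R d half) `^ (- m) in Dh Dh0 *; move=> em; clearbody E N X.
have : 2 * H * (1 - R d half - eps d) <= 2 * H by have : 0 < eps d by []; nra.
move=> h1 /le_trans /(_ h1); rewrite ler_norml => /andP[h2 h3].
have k1 : mub ^+ 2 * X <= mub ^+ 2 * A by rewrite ler_pM2l.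
have k2 : 0 <= mub ^+ 2 * X by rewrite mulr_ge0// ltW.
have h4 : E * (sigma d * q ^+ 2 - mub ^+ 2 * N) <= E * M.
  by rewrite ler_pM2l// /M; lra.
have h5 : E * - M <= E * (sigma d * q ^+ 2 - mub ^+ 2 * N).
  by rewrite ler_pM2l// /M; lra.
have h6 : E * (sigma d * q ^+ 2 - mub ^+ 2 * N) = sigma d * E * q ^+ 2 - mub ^+ 2.
  by rewrite mulrBr (_ : E * (mub ^+ 2 * N) = mub ^+ 2 * (E * N)); [rewrite emE; ring|ring].
rewrite h6 in h4 h5.
have sE : 0 < sigma d * E by rewrite mulr_gt0.
by rewrite mulrN in h5; exact: scale_bounds sE em q1 q2 h4 h5.
Unshelve. all: by end_near. Qed.

(* [inner_scale / eps] is the speed of the time change. *)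
Definition inner_scale d : K := (Num.sqrt (sigma d * eps d `^ m))^-1.

Lemma inner_scale_spec : \forall d \near 0^'+,
  [/\ 0 < inner_scale d, inner_scale d ^+ 2 * (sigma d * eps d `^ m) = 1 & 1 / 3 <= mub * inner_scale d <= 3].
Proof.
have mb := mubar_gt0 m1; have mb2 : 0 < mub ^+ 2 by exact: exprn_gt0.
near=> d.
have /andP[h1 h2] : mub ^+ 2 / 8 <= sigma d * eps d `^ m <= 8 * mub ^+ 2.
  by near: d; exact: sigma_scale.
have N0 : 0 < sigma d * eps d `^ m by apply: lt_le_trans h1; rewrite divr_gt0.
have b0 : 0 < inner_scale d by rewrite invr_gt0 sqrtr_gt0.
have bE : inner_scale d ^+ 2 * (sigma d * eps d `^ m) = 1.
  by rewrite /inner_scale exprVn sqr_sqrtr ?mulVf ?gt_eqF// ltW.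
split=> //; move: bE N0 h1 h2; move: (sigma d * _) => N bE N0 h1 h2.
have mb0 : 0 < mub * inner_scale d by rewrite mulr_gt0.
have E2 : (mub * inner_scale d) ^+ 2 * N = mub ^+ 2 by rewrite -[RHS]mulr1 -bE; ring.
(* Here [z ^ 2] lies between [1 / 8] and [8], hence [z] between [1 / 3] and [3]. *)
move: (mub * inner_scale d) mb0 E2 => z z0 E2; apply/andP; split.
  rewrite leNgt; apply/negP => z1.
  have : z ^+ 2 < 9^-1 by nra.
  by move: (z ^+ 2) E2 => y; nra.
rewrite leNgt; apply/negP => z1.
have : 9 < z ^+ 2 by nra.
by move: (z ^+ 2) E2 => y; nra.
Unshelve. all: by end_near. Qed.

Lemma sigma_inv : \forall d \near 0^'+, (sigma d)^-1 <= 8 / mub ^+ 2 * eps d `^ m.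
Proof.
have mb := mubar_gt0 m1; have mb2 : 0 < mub ^+ 2 by exact: exprn_gt0.
near=> d.
have [PV [PF [Q w]]] : has_wave d by near: d; exact: has_wave_near.
have s0 := w_s0 w.
have /andP[h1 h2] : mub ^+ 2 / 8 <= sigma d * eps d `^ m <= 8 * mub ^+ 2.
  by near: d; exact: sigma_scale.
rewrite -(ler_pM2l s0) mulfV ?gt_eqF// mulrCA mulrAC ler_pdivlMr//.
by lra.
Unshelve. all: by end_near. Qed.

(** * The profile inside [[0, 1/2]] as a time change of [S0] *)

Lemma wave_time_change : exists2 C, 0 < C & \forall d \near 0^'+,
  exists tau : K -> K, forall y, 0 <= y <= half ->
    [/\ 0 <= tau y, 1 - R d y = eps d * (1 + S0 (tau y)),
      `|eps d * tau y - inner_scale d * y| <= C * eps d `^ m * inner_scale d * y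
      & `|D1 (V d) y - inner_scale d * s' (tau y)| <= C * eps d `^ m * inner_scale d * s' (tau y)].
Proof.
have mb := mubar_gt0 m1; have mb2 : 0 < mub ^+ 2 by exact: exprn_gt0.
pose H := rest_bound m; have H0 : 0 < H by exact: rest_bound_gt0.
pose C := 2 * H / mub ^+ 2; have C0 : 0 < C by rewrite divr_gt0// mulr_gt0.
exists C => //; near=> d.
have [PV [PF [Q w]]] : has_wave d by near: d; exact: has_wave_near.
have e0 : 0 < eps d by exact: eps_gt0 w.
have s0 := w_s0 w.
have e1 : eps d <= 1 by near: d; exact: eps_small.
have eH : eps d <= 1 / ((m + 1) * H).
  by near: d; apply: eps_small; rewrite divr_gt0// mulr_gt0.
have [b0 bE _] : [/\ 0 < inner_scale d, inner_scale d ^+ 2 * (sigma d * eps d `^ m) = 1 & 1 / 3 <= mub * inner_scale d <= 3].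
  by near: d; exact: inner_scale_spec.
have em0 : 0 < eps d `^ m by exact: powR_gt0.
have kC : C * eps d `^ m <= 1.
  have : eps d `^ m <= C^-1 by near: d; apply: eps_powm_small; rewrite invr_gt0.
  by move=> h; rewrite -(mulfV (lt0r_neq0 C0)) ler_pM2l.
have big : H < 2 / (m + 1) * eps d `^ (- (m + 1)).
  have p0 : 0 < eps d `^ (m + 1) by exact: powR_gt0.
  have pe : eps d `^ (m + 1) <= eps d.
    by apply: ge1r_powR; [rewrite e0 e1|rewrite lerDr ltW].
  rewrite powRN ltr_pdivlMr// ltr_pdivlMr//.
  move: eH; rewrite ler_pdivlMr; last exact: mulr_gt0.
  have q0 : 0 < (m + 1) * H by exact: mulr_gt0.
  have -> : H * eps d `^ (m + 1) * (m + 1) = eps d `^ (m + 1) * ((m + 1) * H) by ring.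
  move: pe p0 q0; move: (eps d `^ (m + 1)) (eps d) ((m + 1) * H) => p e q pe p0 q0 eH; nra.
have [|||||||tau Ht] := @time_change K m S0 m1 hS (fun y => (1 - R d y) / eps d - 1)
    (fun y => D1 (V d) y / eps d) half (inner_scale d / eps d) (C * eps d `^ m).
- by rewrite divr_gt0.
- by rewrite kC andbT mulr_ge0// ltW.
- by rewrite mulfV ?gt_eqF// subrr.
- move=> y _; apply: (der_conv (der_add (der_mul (der_D w y) (der_cst (eps d)^-1 y)) (der_opp (der_cst 1 y)))); ring.
- move=> y yh; have := D_gt_eps m1 w big yh.
  by rewrite -/(eps d) subr_gt0 ltr_pdivlMr// mul1r.
- by move=> y yh; rewrite divr_ge0 ?(ltW e0)//; exact: D1_ge0 w _ yh.
- move=> y yh; have /andP[y0 _] := yh.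
  have D0 := D_gt0 w y; have Dle := D_le1 w y; have De := D_mono w (lexx 0) y0.
  rewrite -/(eps d) in De.
  have := wave_energy m1 w yh; rewrite -/(eps d) -/H.
  have -> : 1 + ((1 - R d y) / eps d - 1) = (1 - R d y) / eps d by ring.
  have -> : ((1 - R d y) / eps d) `^ (- m) = eps d `^ m * (1 - R d y) `^ (- m).
    rewrite powRM ?invr_ge0 ?(ltW D0) ?(ltW e0)// mulrC; congr (_ * _).
    by rewrite -powR_inv1 ?(ltW e0)// -powRrM mulN1r opprK.
  set DD := 1 - R d y in D0 Dle De *; set X := DD `^ (- m); set E := eps d `^ m in em0 kC bE *.
  have EN : E * eps d `^ (- m) = 1 by rewrite powRN mulfV// gt_eqF.
  (* This makes the error relative: with [r = eps / D <= 1], [r ^ m <= r], and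
     [1 - r = (D - eps) / D >= D - eps] because [D <= 1]. *)
  have pr : DD - eps d <= 1 - E * X.
    have -> : E * X = (eps d / DD) `^ m.
      by rewrite powRM ?invr_ge0 ?(ltW D0) ?(ltW e0)// -powR_inv1 ?(ltW D0)// -powRrM mulN1r.
    have r1 : eps d / DD <= 1 by rewrite ler_pdivrMr// mul1r.
    have : (eps d / DD) `^ m <= eps d / DD.
      by apply: ge1r_powR; rewrite ?divr_gt0 ?r1// ltW.
    have : eps d / DD * DD = eps d by rewrite divfK// gt_eqF.
    move: (eps d / DD) r1 => r r1 rE; move: (r `^ m) => {}X; nra.
  have L : (inner_scale d / eps d) ^+ 2 * (sigma d * E * eps d ^+ 2) = 1.
    by rewrite -bE; field; rewrite gt_eqF.
  set l2 := (inner_scale d / eps d) ^+ 2 in L *; set a := D1 (V d) y.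
  have l20 : 0 < l2 by rewrite exprn_gt0// divr_gt0.
  have -> : (a / eps d) ^+ 2 = l2 * E * (sigma d * a ^+ 2).
    by rewrite -[LHS]mulr1 -L; field; rewrite gt_eqF.
  have -> : l2 * E * (sigma d * a ^+ 2) - l2 * (mub ^+ 2 * (1 - E * X)) =
      l2 * E * (sigma d * a ^+ 2 - mub ^+ 2 * (eps d `^ (- m) - X)).
    by rewrite -{1}EN; ring.
  have lE : 0 < l2 * E by exact: mulr_gt0.
  have H2 : 0 < 2 * H by exact: mulr_gt0.
  move=> h; rewrite normrM (gtr0_norm lE).
  apply: (@le_trans _ _ (l2 * E * (2 * H * (DD - eps d)))).
    by rewrite ler_pM2l.
  have -> : C * E * (l2 * (mub ^+ 2 * (1 - E * X))) = l2 * E * (2 * H * (1 - E * X)).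
    by rewrite /C; field; rewrite gt_eqF.
  by rewrite (ler_pM2l lE) (ler_pM2l H2).
exists tau => y yh; have [h1 h2 h3 h4] := Ht y yh; split => //.
- by rewrite -h2 subrKC mulrC divfK// gt_eqF.
- have -> : eps d * tau y - inner_scale d * y = eps d * (tau y - inner_scale d / eps d * y).
    by field; rewrite gt_eqF.
  rewrite normrM gtr0_norm//.
  have -> : C * eps d `^ m * inner_scale d * y = eps d * (C * eps d `^ m * (inner_scale d / eps d) * y).
    by field; rewrite gt_eqF.
  by rewrite ler_pM2l.
- have -> : D1 (V d) y - inner_scale d * s' (tau y) =
      eps d * (D1 (V d) y / eps d - inner_scale d / eps d * s' (tau y)) by field; rewrite gt_eqF.
  rewrite normrM gtr0_norm//.
  have -> : C * eps d `^ m * inner_scale d * s' (tau y) =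
      eps d * (C * eps d `^ m * (inner_scale d / eps d) * s' (tau y)) by field; rewrite gt_eqF.
  by rewrite ler_pM2l.
Unshelve. all: by end_near. Qed.

(** * Matching at [1/2], the explicit scale, and [sigma] *)

Ltac pos := first [assumption | done | lazymatch goal with
  | |- is_true (0 < _ + _) => apply: addr_gt0; pos
  | |- is_true (0 < _ * _) => apply: mulr_gt0; pos
  | |- is_true (0 < _ ^-1) => rewrite invr_gt0; pos
  | |- is_true (0 < _ ^+ _) => apply: exprn_gt0; pos
  | |- is_true (0 < _ `^ _) => apply: powR_gt0; pos
  | |- is_true (0 <= _ `^ _) => apply: powR_ge0
  | |- is_true (0 <= _ + _) => apply: addr_ge0; pos
  | |- is_true (0 <= _ * _) => apply: mulr_ge0; pos
  | |- is_true (0 <= _ ^-1) => rewrite invr_ge0; pos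
  | |- is_true (0 <= _ ^+ _) => apply: exprn_ge0; pos
  | |- is_true (0 <= _) => apply: ltW; pos
  end].

Lemma inner_scale_ge (b : K) : 0 < mub -> 1 / 3 <= mub * b -> (3 * mub)^-1 <= b.
Proof.
move=> mb h; have m3 : 0 < 3 * mub by pos.
by rewrite -(ler_pM2l m3) (mulfV (lt0r_neq0 m3)) -mulrA; lra.
Qed.

Lemma quarter_bounds (x b k : K) : 0 < b -> k <= 1 / 2 -> `|x - b / 2| <= k * b / 2 ->
  b / 4 <= x <= b.
Proof. by rewrite ler_norml => b0 k1 /andP[h1 h2]; apply/andP; split; nra. Qed.

Lemma normD_le (x y a b : K) : `|x| <= a -> `|y| <= b -> `|x + y| <= a + b.
Proof. by move=> xa yb; apply: le_trans (ler_normD _ _) (lerD xa yb). Qed.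

(** For [T] of order [1 / e], the two errors of [S0_asymp] rescale to [e * T ^ (1 - m)] and
    [T ^ -m], both [O(e ^ m)]. *)
Lemma S0_scaled a b : 0 < a -> 0 < b -> exists2 C, 0 < C & forall e T : K, 0 < e ->
  a <= e * T <= b ->
  `|e * S0 T - (mub * (e * T) - kap * e)| <= C * e `^ m /\ `|s' T - mub| <= C * e `^ m.
Proof.
move=> a0 b0; have [C C0 HC] := S0_asymp m1 hS.
have A0 : 0 < a `^ (- m) by exact: powR_gt0.
exists (C * a `^ (- m) * (b + 1)) => [|e T e0 /andP[aT Tb]]; first by pos.
have T0 : 0 < T by rewrite -(pmulr_rgt0 _ e0) (lt_le_trans a0).
have [h1 /andP[h2 h3]] := HC T T0.
have E0 : 0 < e `^ m by exact: powR_gt0.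
have TE : T `^ (- m) <= a `^ (- m) * e `^ m.
  have -> : a `^ (- m) * e `^ m = (a / e) `^ (- m).
    rewrite powRM ?invr_ge0 ?ltW//; congr (_ * _).
    by rewrite -powR_inv1 ?ltW// -powRrM mulrN mulN1r opprK.
  by apply: powRN_le; [exact: ltW|exact: divr_gt0|rewrite ler_pdivrMr// mulrC].
have T1 : T `^ (1 - m) = T * T `^ (- m).
  by rewrite powRD ?(gt_eqF T0) ?implybT// powRr1// ltW.
set P := T `^ (- m) in TE T1 h3.
have P0 : 0 <= P by exact: powR_ge0.
split; last first.
  rewrite distrC ger0_norm//; apply: (le_trans h3).
  rewrite -!mulrA ler_wpM2l ?(ltW C0)//; apply: (le_trans TE).
  by rewrite ler_pM2l// ler_peMl ?(ltW E0)// lerDr ltW.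
have -> : e * S0 T - (mub * (e * T) - kap * e) = e * (S0 T - (mub * T - kap)) by ring.
rewrite normrM gtr0_norm//; apply: (@le_trans _ _ (C * (e * T) * P)).
  have -> : C * (e * T) * P = e * (C * (T * P)) by ring.
  by rewrite -T1 ler_pM2l.
have eT0 : 0 <= e * T by pos.
rewrite -!mulrA ler_wpM2l ?(ltW C0)//.
apply: (@le_trans _ _ ((e * T) * (a `^ (- m) * e `^ m))).
  by rewrite mulrA ler_wpM2l.
rewrite mulrCA ler_pM2l// ler_pM2r//.
by apply: (le_trans Tb); rewrite lerDl.
Qed.

Lemma eps_powm_small_scaled (C e : K) : 0 < C -> 0 < e -> \forall d \near 0^'+, C * eps d `^ m <= e.
Proof.
move=> C0 e0; near=> d.
have : eps d `^ m <= e / C by near: d; apply: eps_powm_small; exact: divr_gt0.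
by rewrite ler_pdivlMr// mulrC.
Unshelve. all: by end_near. Qed.

Lemma inv_sigma_far : exists2 C, 0 < C & \forall d \near 0^'+, far_force m / sigma d <= C * eps d `^ m.
Proof.
have mb := mubar_gt0 m1; have mb2 : 0 < mub ^+ 2 by exact: exprn_gt0.
have := far_force_ge0 m1; move: (far_force m) => f f0.
have f1 : 0 < f + 1 by rewrite ltr_wpDl.
exists ((f + 1) * (8 / mub ^+ 2)); first by pos.
near=> d.
have h : (sigma d)^-1 <= 8 / mub ^+ 2 * eps d `^ m by near: d; exact: sigma_inv.
rewrite -mulrA; apply: (@le_trans _ _ (f * (8 / mub ^+ 2 * eps d `^ m))).
  by rewrite ler_wpM2l.
rewrite ler_wpM2r ?lerDl//; pos.
Unshelve. all: by end_near. Qed.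

(** Two readings of [V 0] at [y = 1/2]. The slope [D' = V 0 - V 1] gives [V 0 = mubar * inner_scale]
    up to [O(eps ^ m)]. The value [V 0 / 2], close to [R (1/2) = 1 - eps * (1 + S0 (tau))], is [1 -
    eps - mubar * inner_scale / 2 + kappabar * eps] up to the same order. Equating them yields the
    scale. *)
Lemma matching : exists2 C, 0 < C & \forall d \near 0^'+,
  `|V d 0 - mub * inner_scale d| <= C * eps d `^ m /\
  `|mub * inner_scale d - (1 + eps d * (kap - 1))| <= C * eps d `^ m.
Proof.
have mb := mubar_gt0 m1.
have [Ct Ct0 Htau] := wave_time_change.
have [Fc Fc0 HF] := inv_sigma_far.
have [Cq Cq0 Hq] := @S0_scaled ((12 * mub)^-1) (3 / mub) ltac:(pos) ltac:(pos).
pose C1 := Fc + 3 * Ct + 3 / mub * Cq; pose C2 := Fc + C1 / 2 + 3 / 2 * Ct + Cq.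
have C10 : 0 < C1 by rewrite /C1; pos.
have C20 : 0 < C2 by rewrite /C2; pos.
exists (C1 + C2); first exact: addr_gt0.
near=> d.
have [PV [PF [Q w]]] : has_wave d by near: d; exact: has_wave_near.
have e0 : 0 < eps d := eps_gt0 w; have s0 := w_s0 w.
have [b0 bE /andP[b1 b2]] : [/\ 0 < inner_scale d, inner_scale d ^+ 2 * (sigma d * eps d `^ m) = 1 & 1 / 3 <= mub * inner_scale d <= 3].
  by near: d; exact: inner_scale_spec.
have fs : far_force m / sigma d <= Fc * eps d `^ m by near: d; exact: HF.
have [tau Ht] : exists tau : K -> K, forall y, 0 <= y <= half ->
    [/\ 0 <= tau y, 1 - R d y = eps d * (1 + S0 (tau y)),
      `|eps d * tau y - inner_scale d * y| <= Ct * eps d `^ m * inner_scale d * y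
      & `|D1 (V d) y - inner_scale d * s' (tau y)| <= Ct * eps d `^ m * inner_scale d * s' (tau y)].
  by near: d; exact: Htau.
have ks : Ct * eps d `^ m <= 1 / 2 by near: d; apply: eps_powm_small_scaled.
have em0 : 0 < eps d `^ m by exact: powR_gt0.
have [T0 TE T1 T2] := Ht half ltac:(by rewrite lexx invr_ge0 ler0n).
have V1 := V1_le m1 w; have Rh := R_half_V0 m1 w; have V10 := w_V0 w 1.
rewrite (D1_half w) in T2.
move: (tau half) T0 TE T1 T2 => T T0 TE T1 T2.
set E := eps d `^ m in em0 ks fs T1 T2 *; set e := eps d in e0 TE T1 *; set b := inner_scale d in b0 b1 b2 T1 T2 *.
have bl : (3 * mub)^-1 <= b by exact: inner_scale_ge.
have bu : b <= 3 / mub by rewrite ler_pdivlMr// mulrC.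
have Tab : (12 * mub)^-1 <= e * T <= 3 / mub.
  have := quarter_bounds b0 ks T1.
  move=> /andP[t1 t2]; rewrite (le_trans t2 bu) andbT; apply: le_trans t1.
  rewrite (_ : (12 * mub)^-1 = (3 * mub)^-1 / 4); last by field; rewrite gt_eqF.
  by rewrite ler_pM2r// invr_gt0.
have [q1 q2] := Hq _ _ e0 Tab; rewrite -/E in q1 q2.
have sT0 := dS0_ge0 m1 hS T0; have sT1 := dS0_le_mubar m1 hS T.
have a1 : `|V d 1| <= Fc * E by rewrite ger0_norm//; exact: le_trans fs.
have a2 : `|V d 0 - V d 1 - b * s' T| <= 3 * Ct * E.
  apply: (le_trans T2); have -> : 3 * Ct * E = Ct * E * 3 by ring.
  rewrite -[leLHS]mulrA ler_wpM2l ?mulr_ge0 ?(ltW Ct0) ?(ltW em0)//.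
  by apply: le_trans b2; rewrite mulrC ler_pM2r.
have a3 : `|b * s' T - mub * b| <= 3 / mub * Cq * E.
  have -> : b * s' T - mub * b = b * (s' T - mub) by ring.
  by rewrite normrM gtr0_norm// -mulrA; apply: ler_pM => //; exact: ltW.
have a4 : `|V d 0 - mub * b| <= C1 * E.
  have := normD_le a1 (normD_le a2 a3).
  rewrite (_ : V d 1 + _ = V d 0 - mub * b); last by ring.
  by rewrite /C1 !mulrDl addrA.
have a5 : `|V d 0 / 2 - R d half| <= Fc * E by rewrite distrC; exact: le_trans fs.
have a6 : `|(mub * b - V d 0) / 2| <= C1 / 2 * E.
  have -> : C1 / 2 * E = C1 * E / 2 by ring.
  have h2 : 0 < half by pos.
  by rewrite normrM distrC (gtr0_norm h2) (ler_pM2r h2).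
have a7 : `|mub * b / 2 - mub * (e * T)| <= 3 / 2 * Ct * E.
  have -> : mub * b / 2 - mub * (e * T) = mub * (b * half - e * T) by ring.
  rewrite normrM distrC gtr0_norm//.
  apply: (@le_trans _ _ (mub * (Ct * E * b * half))); first by rewrite ler_pM2l.
  have -> : mub * (Ct * E * b * half) = (Ct * E * half) * (mub * b) by ring.
  have -> : 3 / 2 * Ct * E = (Ct * E * half) * 3 by field.
  by rewrite ler_wpM2l//; pos.
have a8 : `|mub * (e * T) - kap * e - e * S0 T| <= Cq * E by rewrite distrC.
have a9 : `|mub * b - (1 + e * (kap - 1))| <= C2 * E.
  have := normD_le a5 (normD_le a6 (normD_le a7 a8)).
  rewrite (_ : V d 0 / 2 - _ + _ = mub * b - (1 + e * (kap - 1))); last first.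
    by rewrite (_ : R d half = 1 - e * (1 + S0 T)); [field|rewrite -TE; ring].
  by rewrite /C2 !mulrDl !addrA.
have C1E : 0 <= C1 * E by pos.
have C2E : 0 <= C2 * E by pos.
by split; rewrite (mulrDl C1 C2 E); [apply: (le_trans a4); rewrite lerDl|apply: (le_trans a9); rewrite lerDr].
Unshelve. all: by end_near. Qed.

(** This is [eps / muhat eps], the counterpart of [inner_scale] in the approximation. *)
Definition inner_scale_hat d : K := (1 + eps d * (kap - 1)) / mub.

Lemma inner_scale_hat_spec : exists2 C, 0 < C & \forall d \near 0^'+,
  [/\ 1 / 6 <= mub * inner_scale_hat d <= 4, eps d / muhat m S0 (eps d) = inner_scale_hat d,
      (forall x, x / muhat m S0 (eps d) = x * inner_scale_hat d / eps d) &
      `|inner_scale d - inner_scale_hat d| <= C * eps d `^ m].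
Proof.
have mb := mubar_gt0 m1.
have [C C0 HC] := matching.
exists (C / mub); first exact: divr_gt0.
near=> d.
have e0 : 0 < eps d by near: d; exact: eps_gt0_near.
have [_ h] : `|V d 0 - mub * inner_scale d| <= C * eps d `^ m /\
    `|mub * inner_scale d - (1 + eps d * (kap - 1))| <= C * eps d `^ m by near: d; exact: HC.
have [_ _ /andP[b1 b2]] : [/\ 0 < inner_scale d, inner_scale d ^+ 2 * (sigma d * eps d `^ m) = 1 & 1 / 3 <= mub * inner_scale d <= 3].
  by near: d; exact: inner_scale_spec.
have k : C * eps d `^ m <= 1 / 6 by near: d; apply: eps_powm_small_scaled.
have bhE : mub * inner_scale_hat d = 1 + eps d * (kap - 1) by rewrite /inner_scale_hat mulrC divfK// gt_eqF.
have bh : 1 / 6 <= mub * inner_scale_hat d <= 4.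
  rewrite bhE; move: h; rewrite ler_norml; move: (1 + _) => z /andP[h1 h2].
  by apply/andP; split; lra.
have z0 : 0 < 1 + eps d * (kap - 1).
  by rewrite -bhE; case/andP: bh => + _; apply: lt_le_trans; rewrite divr_gt0.
split=> //.
- rewrite /muhat /inner_scale_hat; move: z0 => /lt0r_neq0 z0; field.
  by rewrite z0 (gt_eqF e0) (gt_eqF mb).
- move=> x; rewrite /muhat /inner_scale_hat; move: z0 => /lt0r_neq0 z0; field.
  by rewrite z0 (gt_eqF e0) (gt_eqF mb).
- rewrite -(ler_pM2l mb) -{1}(gtr0_norm mb) -normrM mulrBr bhE.
  by apply: (le_trans h); rewrite (_ : mub * (C / mub * eps d `^ m) = C * eps d `^ m)//; field; rewrite gt_eqF.
Unshelve. all: by end_near. Qed.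

(** Multiplied by [eps ^ m], [sigma] and [sigmahat] become the inverse squares of [inner_scale] and
    [inner_scale_hat], which are [O(eps ^ m)] apart and bounded away from zero. *)
Lemma sigma_approx : exists2 C, 0 < C & \forall d \near 0^'+,
  eps d `^ m * `|sigma d - sigmahat m S0 (eps d)| <= C * eps d `^ m.
Proof.
have mb := mubar_gt0 m1.
have [C C0 HC] := inner_scale_hat_spec.
pose A := (3 * mub) ^+ 2 * (6 * mub) ^+ 2 * (7 / mub).
have A0 : 0 < A by rewrite /A; pos.
exists (A * C); first exact: mulr_gt0.
near=> d.
have e0 : 0 < eps d by near: d; exact: eps_gt0_near.
have [b0 bE /andP[b1 b2]] : [/\ 0 < inner_scale d, inner_scale d ^+ 2 * (sigma d * eps d `^ m) = 1 & 1 / 3 <= mub * inner_scale d <= 3].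
  by near: d; exact: inner_scale_spec.
have [/andP[h1 h2] hm _ hb] : [/\ 1 / 6 <= mub * inner_scale_hat d <= 4, eps d / muhat m S0 (eps d) = inner_scale_hat d,
      (forall x, x / muhat m S0 (eps d) = x * inner_scale_hat d / eps d) &
      `|inner_scale d - inner_scale_hat d| <= C * eps d `^ m] by near: d; exact: HC.
have em0 : 0 < eps d `^ m by exact: powR_gt0.
have bh0 : 0 < inner_scale_hat d by rewrite -(pmulr_rgt0 _ mb) (lt_le_trans _ h1)// divr_gt0.
have mE : muhat m S0 (eps d) = eps d / inner_scale_hat d.
  by rewrite -hm; rewrite invf_div mulrC divfK// gt_eqF.
have sE : eps d `^ m * sigmahat m S0 (eps d) = (inner_scale_hat d)^-1 ^+ 2.
  rewrite /sigmahat mE powRB ?(gt_eqF e0) ?implybT// powRN.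
  have -> : eps d `^ 2 = eps d ^+ 2 by rewrite powR_mulrn// ltW.
  by field; rewrite (gt_eqF em0) (gt_eqF e0) (gt_eqF bh0).
have s1E : eps d `^ m * sigma d = (inner_scale d)^-1 ^+ 2.
  by rewrite -[RHS]mulr1 -bE; field; rewrite gt_eqF.
rewrite -{1}(gtr0_norm em0) -normrM mulrBr sE s1E.
set E := eps d `^ m in em0 hb *; move: (inner_scale d) (inner_scale_hat d) b0 b1 b2 h1 h2 hb bh0 => b bh b0 b1 b2 h1 h2 hb bh0.
have -> : b^-1 ^+ 2 - bh^-1 ^+ 2 = (bh + b) * (b^-1 ^+ 2 * bh^-1 ^+ 2) * (bh - b).
  by field; rewrite (gt_eqF b0) (gt_eqF bh0).
have ib : b^-1 <= 3 * mub by rewrite -(ler_pM2l b0) mulfV ?gt_eqF//; nra.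
have ibh : bh^-1 <= 6 * mub by rewrite -(ler_pM2l bh0) mulfV ?gt_eqF//; nra.
have sb : bh + b <= 7 / mub by rewrite ler_pdivlMr//; lra.
have ib0 : 0 < b^-1 by rewrite invr_gt0.
have ibh0 : 0 < bh^-1 by rewrite invr_gt0.
have k0 : 0 <= (bh + b) * (b^-1 ^+ 2 * bh^-1 ^+ 2) by pos.
rewrite normrM distrC (ger0_norm k0).
have -> : A * C * E = A * (C * E) by ring.
apply: ler_pM => //; rewrite /A mulrC; apply: ler_pM => //; [by pos|by pos|].
by apply: ler_pM; [by pos|by pos| |]; apply: lerXn2r; rewrite // nnegrE; pos.
Unshelve. all: by end_near. Qed.

(** * Pointwise approximation of [R] and [V] *)

Lemma S0_lip_abs t u : 0 <= t -> 0 <= u -> `|S0 t - S0 u| <= mub * `|t - u|.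
Proof.
move=> t0 u0; have [tu|/ltW ut] := leP t u.
  by rewrite distrC (distrC t) (ger0_norm (x := u - t)) ?subr_ge0//; exact: S0_lip.
by rewrite (ger0_norm (x := t - u)) ?subr_ge0//; exact: S0_lip.
Qed.

Lemma dS0_lip_abs a t u : 0 < a -> a <= t -> a <= u -> `|s' t - s' u| <= mub * `|t - u| / a.
Proof.
move=> a0; have mb := mubar_gt0 m1.
have H x y : a <= x -> x <= y -> `|s' y - s' x| <= mub * (y - x) / a.
  move=> ax xy; have x0 := lt_le_trans a0 ax.
  apply: le_trans (dS0_lip m1 hS x0 xy) _; rewrite ler_wpM2l ?lef_pV2//.
  by rewrite mulr_ge0 ?subr_ge0// ltW.
move=> at_ au; have [tu|/ltW ut] := leP t u.
  by rewrite distrC (distrC t) (ger0_norm (x := u - t)) ?subr_ge0//; exact: H.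
by rewrite (ger0_norm (x := t - u)) ?subr_ge0//; exact: H.
Qed.

Lemma half_below (et b y k : K) : 0 <= y -> 0 <= b -> k <= 1 / 2 ->
  `|et - b * y| <= k * b * y -> b * y / 2 <= et.
Proof.
rewrite ler_norml => y0 b0 k1 /andP[h _]; have : 0 <= b * y by exact: mulr_ge0.
by nra.
Qed.

(** The time [tau y] is replaced by [y / muhat], at distance at most [k0 * eps ^ m * y / eps]. The
    factor [y] compensates the Lipschitz constant of [s'], which is of order [eps / y] on this
    range. *)
Lemma R_D1_approx : exists2 C, 0 < C & \forall d \near 0^'+, forall y, 0 <= y <= half ->
  `|R d y - (1 - eps d - eps d * S0 (y / muhat m S0 (eps d)))| <= C * eps d `^ m /\
  `|D1 (V d) y - inner_scale_hat d * s' (y / muhat m S0 (eps d))| <= C * eps d `^ m.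
Proof.
have mb := mubar_gt0 m1.
have [Ct Ct0 Htau] := wave_time_change.
have [Cb Cb0 HB] := inner_scale_hat_spec.
pose k0 := Ct * (3 / mub) + Cb.
have k00 : 0 < k0 by rewrite /k0; pos.
pose C1 := mub * k0; pose C2 := Ct * 3 + (Cb * mub + 4 / mub * (6 * mub ^+ 2 * k0)).
have C10 : 0 < C1 by rewrite /C1; pos.
have C20 : 0 < C2 by rewrite /C2; pos.
exists (C1 + C2); first by pos.
near=> d => y yh; have /andP[y0 y1] := yh.
have e0 : 0 < eps d by near: d; exact: eps_gt0_near.
have [b0 _ /andP[b1 b2]] : [/\ 0 < inner_scale d, inner_scale d ^+ 2 * (sigma d * eps d `^ m) = 1 & 1 / 3 <= mub * inner_scale d <= 3].
  by near: d; exact: inner_scale_spec.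
have [/andP[bh1 bh2] _ hmu hb] : [/\ 1 / 6 <= mub * inner_scale_hat d <= 4, eps d / muhat m S0 (eps d) = inner_scale_hat d,
      (forall x, x / muhat m S0 (eps d) = x * inner_scale_hat d / eps d) &
      `|inner_scale d - inner_scale_hat d| <= Cb * eps d `^ m] by near: d; exact: HB.
have [tau Ht] : exists tau : K -> K, forall y, 0 <= y <= half ->
    [/\ 0 <= tau y, 1 - R d y = eps d * (1 + S0 (tau y)),
      `|eps d * tau y - inner_scale d * y| <= Ct * eps d `^ m * inner_scale d * y
      & `|D1 (V d) y - inner_scale d * s' (tau y)| <= Ct * eps d `^ m * inner_scale d * s' (tau y)].
  by near: d; exact: Htau.
have ks : Ct * eps d `^ m <= 1 / 2 by near: d; apply: eps_powm_small_scaled.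
have em0 : 0 < eps d `^ m by exact: powR_gt0.
have {Ht}[T0 TE T1 T2] := Ht y yh.
rewrite hmu.
set E := eps d `^ m in em0 ks T1 T2 hb *; set e := eps d in e0 TE T1 *.
move: (tau y) T0 TE T1 T2 => T T0 TE T1 T2.
move: (inner_scale d) b0 b1 b2 T1 T2 hb => b b0 b1 b2 T1 T2 hb.
move: (inner_scale_hat d) bh1 bh2 hb hmu => bh bh1 bh2 hb hmu.
have bh0 : 0 < bh by rewrite -(pmulr_rgt0 _ mb) (lt_le_trans _ bh1)// divr_gt0.
have bu : b <= 3 / mub by rewrite ler_pdivlMr// mulrC.
have bhu : bh <= 4 / mub by rewrite ler_pdivlMr// mulrC.
pose u := y * bh / e; rewrite -/u.
have u0 : 0 <= u by rewrite /u; pos.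
have eu : e * u = y * bh by rewrite /u mulrC divfK// gt_eqF.
have sT0 := dS0_ge0 m1 hS T0; have sT1 := dS0_le_mubar m1 hS T.
have k1 : e * `|T - u| <= k0 * E * y.
  rewrite -{1}(gtr0_norm e0) -normrM mulrBr eu.
  have -> : e * T - y * bh = (e * T - b * y) + (b - bh) * y by ring.
  apply: (@le_trans _ _ (Ct * E * b * y + Cb * E * y)).
    by apply: normD_le => //; rewrite normrM (ger0_norm y0) ler_wpM2r.
  have -> : k0 * E * y = Ct * E * (3 / mub) * y + Cb * E * y by rewrite /k0; ring.
  by rewrite lerD2r ler_wpM2r// ler_wpM2l//; pos.
have yle1 : y <= 1 by apply: (le_trans y1); rewrite invf_le1// ler1n.
have k0E : 0 < k0 * E by pos.
have k2 : k0 * E * y <= k0 * E by apply: ler_piMr => //; exact: ltW.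
have E0 := ltW em0.
have r1 : `|R d y - (1 - e - e * S0 u)| <= C1 * E.
  have -> : R d y - (1 - e - e * S0 u) = e * (S0 u - S0 T).
    by rewrite (_ : R d y = 1 - e * (1 + S0 T)); [ring|rewrite -TE; ring].
  rewrite normrM (gtr0_norm e0).
  apply: (@le_trans _ _ (mub * (e * `|T - u|))).
    by rewrite mulrCA ler_pM2l// distrC; exact: S0_lip_abs.
  by rewrite /C1 -mulrA ler_pM2l//; exact: le_trans k1 k2.
have r2 : `|D1 (V d) y - b * s' T| <= Ct * 3 * E.
  apply: (le_trans T2); have -> : Ct * 3 * E = Ct * E * 3 by ring.
  rewrite -[leLHS]mulrA ler_wpM2l//; first by pos.
  by apply: le_trans b2; rewrite mulrC ler_pM2r.
have r3 : `|(b - bh) * s' T| <= Cb * mub * E.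
  rewrite normrM (ger0_norm sT0); have -> : Cb * mub * E = Cb * E * mub by ring.
  by apply: ler_pM.
have r4 : `|bh * (s' T - s' u)| <= 4 / mub * (6 * mub ^+ 2 * k0) * E.
  rewrite normrM (gtr0_norm bh0) -mulrA; apply: ler_pM => //; first exact: ltW.
  (* At [y = 0] both times vanish; elsewhere the Lipschitz estimate needs a positive lower bound for
     both. *)
  move: (y0); rewrite le_eqVlt => /predU1P[yE|yp].
    have uE : u = 0 by rewrite /u -yE !mul0r.
    have TE0 : T = 0.
      move: T1; rewrite -yE !mulr0 subr0 normr_le0 mulf_eq0 (gt_eqF e0) => /eqP//.
    by rewrite uE TE0 subrr normr0; pos.
  (* Below both times: [e * T >= b * y / 2] with [b >= 1 / (3 * mub)], and [e * u = bh * y] with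
     [bh >= 1 / (6 * mub)]. *)
  pose a := y / (6 * mub * e).
  have a0 : 0 < a by rewrite /a; pos.
  have ae : a * e = y / (6 * mub) by rewrite /a; field; rewrite (gt_eqF mb) (gt_eqF e0).
  have aT : a <= T.
    rewrite -(ler_pM2r e0) ae mulrC (mulrC T); apply: le_trans (half_below y0 (ltW b0) ks T1).
    have -> : (6 * mub)^-1 * y = (3 * mub)^-1 * y / 2 by field; rewrite gt_eqF.
    by rewrite ler_wpM2r ?ler_wpM2r// inner_scale_ge.
  have au : a <= u.
    rewrite -(ler_pM2r e0) ae (mulrC u) eu ler_pM2l//.
    have m6 : 0 < 6 * mub by pos.
    rewrite -(ler_pM2l m6) (mulfV (lt0r_neq0 m6)); move: bh1; rewrite ler_pdivrMr//.
    by rewrite (_ : 6 * mub * bh = mub * bh * 6)//; ring.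
  apply: le_trans (dS0_lip_abs a0 aT au) _.
  rewrite ler_pdivrMr//.
  have -> : 6 * mub ^+ 2 * k0 * E * a = mub * (k0 * E * y / e).
    by rewrite /a; field; rewrite (gt_eqF mb) (gt_eqF e0).
  by rewrite ler_pM2l// ler_pdivlMr// mulrC.
have r5 : `|D1 (V d) y - bh * s' u| <= C2 * E.
  have := normD_le r2 (normD_le r3 r4).
  rewrite (_ : D1 (V d) y - b * s' T + _ = D1 (V d) y - bh * s' u); last by ring.
  by rewrite /C2 !mulrDl.
have C1E : 0 <= C1 * E by pos.
have C2E : 0 <= C2 * E by pos.
by split; rewrite (mulrDl C1 C2 E); [apply: (le_trans r1); rewrite lerDl|apply: (le_trans r5); rewrite lerDr].
Unshelve. all: by end_near. Qed.

(** With [y = |x - 1/2|], [V x] is half of the sum [V (1/2 - y) + V (1/2 + y)], nearly constant,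
    plus or minus half of [D' y], according to the side of [1/2]. *)
Lemma V_approx : exists2 C, 0 < C & \forall d \near 0^'+, forall x, 0 <= x < 1 ->
  `|V d x - Vhat m S0 (eps d) x| <= C * eps d `^ m.
Proof.
have mb := mubar_gt0 m1.
have [Cm Cm0 HM] := matching.
have [Cb Cb0 HB] := inner_scale_hat_spec.
have [Cd Cd0 HD] := R_D1_approx.
have [Fc Fc0 HF] := inv_sigma_far.
pose C1 := 2 * Fc + (Cm + mub * Cb).
have C10 : 0 < C1 by rewrite /C1; pos.
exists (C1 + Cd); first by pos.
near=> d => x /andP[x0 x1].
have [PV [PF [Q w]]] : has_wave d by near: d; exact: has_wave_near.
have s0 := w_s0 w.
have e0 : 0 < eps d by near: d; exact: eps_gt0_near.
have em0 : 0 < eps d `^ m by exact: powR_gt0.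
have fs : far_force m / sigma d <= Fc * eps d `^ m by near: d; exact: HF.
have [c1 _] : `|V d 0 - mub * inner_scale d| <= Cm * eps d `^ m /\
    `|mub * inner_scale d - (1 + eps d * (kap - 1))| <= Cm * eps d `^ m by near: d; exact: HM.
have [_ hm _ hb] : [/\ 1 / 6 <= mub * inner_scale_hat d <= 4, eps d / muhat m S0 (eps d) = inner_scale_hat d,
      (forall x, x / muhat m S0 (eps d) = x * inner_scale_hat d / eps d) &
      `|inner_scale d - inner_scale_hat d| <= Cb * eps d `^ m] by near: d; exact: HB.
have HD' : forall y, 0 <= y <= half ->
  `|R d y - (1 - eps d - eps d * S0 (y / muhat m S0 (eps d)))| <= Cd * eps d `^ m /\
  `|D1 (V d) y - inner_scale_hat d * s' (y / muhat m S0 (eps d))| <= Cd * eps d `^ m.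
  by near: d; exact: HD.
rewrite /Vhat (ger0_norm x0) x1 hm /W0.
set E := eps d `^ m in em0 fs c1 hb HD' *.
have sum y : 0 <= y <= half -> `|V d (half - y) + V d (half + y) - mub * inner_scale_hat d| <= C1 * E.
  move=> yh; have a1 := V_sum m1 w yh.
  have {}a1 : `|V d (half - y) + V d (half + y) - V d 0| <= 2 * Fc * E.
    have -> : 2 * Fc * E = 2 * (Fc * E) by ring.
    by apply: (le_trans a1); rewrite -[leLHS]mulrA ler_pM2l.
  have a2 : `|mub * (inner_scale d - inner_scale_hat d)| <= mub * Cb * E.
    by rewrite normrM gtr0_norm// -mulrA ler_pM2l.
  have := normD_le a1 (normD_le c1 a2).
  rewrite (_ : V d (half - y) + _ - _ + _ = V d (half - y) + V d (half + y) - mub * inner_scale_hat d); last by ring.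
  by rewrite /C1 !mulrDl.
have h2 : 0 < half by pos.
have fin A B : `|A| <= C1 * E -> `|B| <= Cd * E -> `|half * (A + B)| <= (C1 + Cd) * E.
  move=> a b; rewrite normrM (gtr0_norm h2) mulrDl; have := normD_le a b.
  move=> h; apply: (@le_trans _ _ (half * (C1 * E + Cd * E))); first by rewrite ler_pM2l.
  rewrite mulrC; apply: ler_piMr; [by pos|by rewrite invf_le1// ler1n].
have [xh|/ltW hx] := leP x half.
  have yh : 0 <= half - x <= half by rewrite subr_ge0 xh lerBlDr lerDl x0.
  have a := sum _ yh; have [_ b] := HD' _ yh.
  have := fin _ _ a b; congr (`|_| <= _).
  rewrite (D1E w) (_ : half - (half - x) = x); last by ring.
  by field.
have yh : 0 <= x - half <= half by rewrite subr_ge0 hx; lra.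
have a := sum _ yh; have [_ b] := HD' _ yh; rewrite -normrN in b.
have := fin _ _ a b; congr (`|_| <= _).
rewrite (D1E w) (_ : half + (x - half) = x); last by ring.
rewrite (_ : (half - x) / muhat m S0 (eps d) = - ((x - half) / muhat m S0 (eps d))); last by ring.
(* To the right of [1/2] the argument of [W0] is nonpositive, and the oddness of [s'] supplies the
   minus sign. *)
rewrite (dS0_N m1 hS _).1.
by field.
Unshelve. all: by end_near. Qed.

Lemma half_window (y : K) : half < y -> y < 3 / 2 -> 0 <= y - half < 1 /\ 1 <= y + half.
Proof. by move=> *; split; [apply/andP; split|]; lra. Qed.

Lemma half_window_le (y : K) : half <= y -> y <= 3 / 2 -> 0 <= y - half <= 1.
Proof. by move=> *; apply/andP; split; lra. Qed.

Lemma inner_scale_window (z : K) : 1 / 6 <= z -> z <= 4 -> (1 <= 6 * z) && (z / 2 <= 3).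
Proof. by move=> *; apply/andP; split; lra. Qed.

Lemma der_T0 (x : K) : is_derive x 1 (T0 m S0) (W0 m S0 x).
Proof.
apply: (der_conv (der_mul (der_cst half x) (der_add (der_add (der_S0 hS x) (der_mul (der_cst mub x) (der_id x))) (der_cst kap x)))).
by rewrite /W0; ring.
Qed.

(** Integration from [1/2] of [R' x = V (x + 1/2) - V (x - 1/2)]: the first term is [O(1 / sigma)],
    and the approximation has derivative [- Vhat (x - 1/2)]. At [1/2], both sides are close to
    [V 0 / 2], where the constant [kappabar] in [T0] cancels the one in the asymptotics of [S0]. *)
Lemma R_approx_outer : exists2 C, 0 < C & \forall d \near 0^'+, forall x, half <= x -> x <= 3 / 2 ->
  `|R d x - eps d * T0 m S0 ((1 - x) / muhat m S0 (eps d))| <= C * eps d `^ m.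
Proof.
have mb := mubar_gt0 m1.
have [Cm Cm0 HM] := matching.
have [Cb Cb0 HB] := inner_scale_hat_spec.
have [Cv Cv0 HV] := V_approx.
have [Fc Fc0 HF] := inv_sigma_far.
have [Cq Cq0 Hq] := @S0_scaled ((12 * mub)^-1) (3 / mub) ltac:(pos) ltac:(pos).
pose C1 := Fc + (Cm / 2 + (mub * Cb / 2 + Cq / 2)); pose M := Fc + Cv.
have C10 : 0 < C1 by rewrite /C1; pos.
have M0 : 0 < M by rewrite /M; pos.
exists (C1 + M); first by pos.
near=> d => x hx x3.
have [PV [PF [Q w]]] : has_wave d by near: d; exact: has_wave_near.
have s0 := w_s0 w.
have e0 : 0 < eps d by near: d; exact: eps_gt0_near.
have em0 : 0 < eps d `^ m by exact: powR_gt0.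
have fs : far_force m / sigma d <= Fc * eps d `^ m by near: d; exact: HF.
have [c1 _] : `|V d 0 - mub * inner_scale d| <= Cm * eps d `^ m /\
    `|mub * inner_scale d - (1 + eps d * (kap - 1))| <= Cm * eps d `^ m by near: d; exact: HM.
have [/andP[bh1 bh2] hm hmu hb] : [/\ 1 / 6 <= mub * inner_scale_hat d <= 4, eps d / muhat m S0 (eps d) = inner_scale_hat d,
      (forall x, x / muhat m S0 (eps d) = x * inner_scale_hat d / eps d) &
      `|inner_scale d - inner_scale_hat d| <= Cb * eps d `^ m] by near: d; exact: HB.
have HV' : forall x, 0 <= x < 1 -> `|V d x - Vhat m S0 (eps d) x| <= Cv * eps d `^ m.
  by near: d; exact: HV.
have V1 := V1_le m1 w; have Rh := R_half_V0 m1 w.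
pose mh := muhat m S0 (eps d); rewrite -/mh in hm hmu *.
pose f x := R d x - eps d * T0 m S0 ((1 - x) / mh).
have df (y : K) : is_derive y 1 f (V d (y + half) - V d (y - half) + eps d / mh * W0 m S0 ((1 - y) / mh)).
  have d1 : is_derive y 1 (fun z : K => (1 - z) / mh) (- mh^-1).
    by apply: (der_conv (der_mul (der_add (der_cst 1 y) (der_opp (der_id y))) (der_cst mh^-1 y))); ring.
  apply: (der_conv (der_add (der_R w y) (der_opp (der_mul (der_cst (eps d) y) (@der_comp _ (T0 m S0) _ _ _ _ (der_T0 _) d1))))).
  by ring.
have dfb y : half < y < x -> `|V d (y + half) - V d (y - half) + eps d / mh * W0 m S0 ((1 - y) / mh)|
    <= M * eps d `^ m.
  move=> /andP[hy yx].
  have [z01 y1] := half_window hy (lt_le_trans yx x3).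
  have := HV' _ z01; rewrite /Vhat -/mh; case/andP: z01 => z0 z1.
  rewrite (ger0_norm z0) z1 (_ : half - (y - half) = 1 - y); last by field.
  rewrite -normrN => b.
  have a : `|V d (y + half)| <= Fc * eps d `^ m.
    rewrite (ger0_norm (w_V0 w _)); apply: le_trans fs; apply: le_trans V1.
    exact: w_Vmono w _ _ ler01 y1.
  have := normD_le a b; rewrite -mulrDl; congr (`|_| <= _).
  by ring.
have fx : `|f x - f half| <= M * eps d `^ m.
  have := @le_incr_norm _ f (fun y => M * eps d `^ m * y) _ (fun=> M * eps d `^ m) half x hx (fun y _ => df y).
  move=> H; apply: (@le_trans _ _ (M * eps d `^ m * x - M * eps d `^ m * half)).
    by apply: H => // y _; apply: (der_conv (der_mul (der_cst _ y) (der_id y))); ring.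
  rewrite -mulrBr; have /andP[z0 z1] := half_window_le hx x3; apply: ler_piMr => //; by pos.
pose u := half * inner_scale_hat d / eps d.
have uE : (1 - half) / mh = u by rewrite hmu /u; congr (_ * _ / _); field.
have eu : eps d * u = inner_scale_hat d / 2 by rewrite /u; field; rewrite gt_eqF.
have bh0 : 0 < inner_scale_hat d by rewrite -(pmulr_rgt0 _ mb) (lt_le_trans _ bh1)// divr_gt0.
have uab : (12 * mub)^-1 <= eps d * u <= 3 / mub.
  rewrite eu; have m12 : 0 < 12 * mub by pos.
  rewrite -(ler_pM2l m12) (mulfV (lt0r_neq0 m12)) ler_pdivlMr//.
  have -> : 12 * mub * (inner_scale_hat d / 2) = 6 * (mub * inner_scale_hat d) by field.
  have -> : inner_scale_hat d / 2 * mub = (mub * inner_scale_hat d) / 2 by field.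
  exact: inner_scale_window bh1 bh2.
have [q1 _] := Hq _ _ e0 uab.
have fh : `|f half| <= C1 * eps d `^ m.
  have h2 : 0 < half by pos.
  have a1 : `|R d half - V d 0 / 2| <= Fc * eps d `^ m by exact: le_trans fs.
  have a2 : `|(V d 0 - mub * inner_scale d) / 2| <= Cm / 2 * eps d `^ m.
    by rewrite normrM (gtr0_norm h2) [leRHS]mulrAC (ler_pM2r h2).
  have a3 : `|mub * (inner_scale d - inner_scale_hat d) / 2| <= mub * Cb / 2 * eps d `^ m.
    rewrite normrM (gtr0_norm h2) [leRHS]mulrAC (ler_pM2r h2) normrM gtr0_norm//.
    by rewrite -[leRHS]mulrA ler_pM2l.
  have a4 : `|- (eps d * S0 u - (mub * (eps d * u) - kap * eps d)) / 2| <= Cq / 2 * eps d `^ m.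
    by rewrite normrM (gtr0_norm h2) [leRHS]mulrAC (ler_pM2r h2) normrN.
  have := normD_le a1 (normD_le a2 (normD_le a3 a4)).
  rewrite /C1 !(mulrDl _ _ (eps d `^ m)); congr (`|_| <= _).
  rewrite /f uE /T0.
  have bE : inner_scale_hat d = 2 * (eps d * u) by rewrite eu; field.
  clearbody u; rewrite bE.
  by field.
rewrite (mulrDl C1 M); have := normD_le fh fx; congr (`|_| <= _).
by rewrite addrC subrK.
Unshelve. all: by end_near. Qed.

Lemma quarter_bump (x : K) : 0 <= x -> x <= 3 / 2 -> 1 <= 4 * bump x.
Proof.
move=> x0 x3; have h : 0 < 1 + x ^+ 2 by rewrite ltr_wpDr ?sqr_ge0.
by rewrite /bump ler_pdivlMr// mul1r; nra.
Qed.

Lemma norm_bump (x : K) : bump `|x| = bump x.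
Proof. by rewrite /bump real_normK// num_real. Qed.

Lemma pointwise : exists2 C, 0 < C & \forall d \near 0^'+, forall x,
  `|R d x - Rhat m S0 (eps d) x| <= C * eps d `^ m * bump x /\
  `|V d x - Vhat m S0 (eps d) x| <= C * eps d `^ m * bump x.
Proof.
have [Cv Cv0 HV] := V_approx.
have [Cd Cd0 HD] := R_D1_approx.
have [Cr Cr0 HR] := R_approx_outer.
have [Fc Fc0 HF] := inv_sigma_far.
(* The factor [4] pays for the weight on [[0, 3/2]], where [bump >= 1 / 4]; [32] is the constant of
   [R_tail] and exceeds that of [V_tail]. *)
pose C := 4 * (Cv + (Cd + Cr)) + 32 * Fc.
have C0 : 0 < C by rewrite /C; pos.
exists C => //; near=> d => x.
have [PV [PF [Q w]]] : has_wave d by near: d; exact: has_wave_near.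
have s0 := w_s0 w.
have e0 : 0 < eps d by near: d; exact: eps_gt0_near.
have em0 : 0 < eps d `^ m by exact: powR_gt0.
have fs : far_force m / sigma d <= Fc * eps d `^ m by near: d; exact: HF.
have HV' : forall x, 0 <= x < 1 -> `|V d x - Vhat m S0 (eps d) x| <= Cv * eps d `^ m.
  by near: d; exact: HV.
have HR' : forall x, half <= x -> x <= 3 / 2 ->
  `|R d x - eps d * T0 m S0 ((1 - x) / muhat m S0 (eps d))| <= Cr * eps d `^ m.
  by near: d; exact: HR.
have HD' : forall y, 0 <= y <= half ->
  `|R d y - (1 - eps d - eps d * S0 (y / muhat m S0 (eps d)))| <= Cd * eps d `^ m /\
  `|D1 (V d) y - inner_scale_hat d * s' (y / muhat m S0 (eps d))| <= Cd * eps d `^ m.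
  by near: d; exact: HD.
have sl : linear_force_bound m / sigma d <= 4^-1.
  rewrite ler_pdivrMr// mulrC ler_pdivlMr//; near: d; exact: sigma_large.
set E := eps d `^ m in em0 fs HV' HR' HD' *.
have V1 : V d 1 <= Fc * E by exact: le_trans (V1_le m1 w) fs.
have core c y z : 0 <= y -> y <= 3 / 2 -> 0 < c -> 4 * c <= C -> z <= c * E -> z <= C * E * bump y.
  move=> y0 y3 c0 cC zc; apply: (le_trans zc).
  apply: (@le_trans _ _ (c * E * (4 * bump y))).
    have cE : 0 <= c * E by pos.
    by rewrite ler_peMr// quarter_bump.
  have -> : c * E * (4 * bump y) = (4 * c) * (E * bump y) by ring.
  by rewrite -[leRHS]mulrA ler_pM2r// mulr_gt0// bump_gt0.
have tl c y z : 0 < c -> c <= 32 -> z <= c * V d 1 * bump y -> z <= C * E * bump y.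
  move=> c0 c32 zc; apply: (le_trans zc); rewrite ler_wpM2r ?(ltW (bump_gt0 _))//.
  apply: (@le_trans _ _ (32 * (Fc * E))).
    by apply: ler_pM => //; [exact: ltW|exact: w_V0 w _].
  by rewrite mulrA ler_pM2r// /C lerDr; pos.
have pos_case y : 0 <= y ->
  `|R d y - Rhat m S0 (eps d) y| <= C * E * bump y /\
  `|V d y - Vhat m S0 (eps d) y| <= C * E * bump y.
  move=> y0; split.
    rewrite /Rhat (ger0_norm y0); case: ltP => [yh|hy].
      have yh' : 0 <= y <= half by rewrite y0 ltW.
      have [h _] := HD' y yh'; apply: (core Cd) h => //; first by lra.
      by rewrite /C; lra.
    case: ltP => [y3|y3].
      apply: (core Cr) (HR' y hy (ltW y3)) => //; first exact: ltW.
      by rewrite /C; lra.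
    rewrite subr0 (ger0_norm (w_R0 w _)).
    have rt := R_tail m1 w sl y3.
    by apply: (tl 32).
  have [y1|y1] := ltP y 1.
    apply: (core Cv) (HV' y _) => //; [lra|by rewrite /C; lra|by rewrite y0].
  rewrite /Vhat (ger0_norm y0) ltNge y1 /= mulr0 subr0 (ger0_norm (w_V0 w _)).
  have vt := V_tail m1 w sl y1.
  by apply: (tl 8) => //; rewrite ler_nat.
have := pos_case `|x| (normr_ge0 x); rewrite norm_bump /Rhat /Vhat normr_id.
have -> : R d `|x| = R d x by case: (ler0P x) => _ //; exact: w_Rev w _.
by have -> : V d `|x| = V d x by case: (ler0P x) => _ //; exact: w_Vev w _.
Unshelve. all: by end_near. Qed.

(** * The amplitude against the norm defect *)

Lemma eps_pow_small p t : 0 < p -> 0 < t -> \forall d \near 0^'+, eps d `^ p <= t.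
Proof.
move=> p0 t0; near=> d.
have e0 : 0 < eps d by near: d; exact: eps_gt0_near.
have et : eps d <= t `^ p^-1 by near: d; apply: eps_small; exact: powR_gt0.
apply: (@le_trans _ _ ((t `^ p^-1) `^ p)).
  apply: ge0_ler_powR => //; first exact: ltW.
  - by rewrite nnegrE ltW.
  - by rewrite nnegrE powR_ge0.
by rewrite -powRrM mulVf ?gt_eqF// powRr1// ltW.
Unshelve. all: by end_near. Qed.

(** From [(B - D) * B <= |B ^ 2 - D ^ 2|], with [B ^ 2] between [1 / 9] and [9]. Bounding [B + D]
    below by [B] is crude, but the final coefficient [1 - 1 / m] remains positive. *)
Lemma sqr_defect_le (B D p k E : K) : 1 / 3 <= B -> B <= 3 -> 0 <= D -> 0 <= p -> p <= 1 -> 0 <= E -> E <= 1 ->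
  0 <= k -> `|D ^+ 2 - B ^+ 2 * (1 - p)| <= k * E ->
  (B - D) ^+ 2 <= B ^+ 2 * p ^+ 2 + 9 * (18 * k + k ^+ 2) * E.
Proof.
move=> B3 B1 D0 p0 p1 E0 E1 k0 h.
have B0 : 0 < B by lra.
pose X := B ^+ 2 * p + k * E.
have kE : 0 <= k * E by exact: mulr_ge0.
have Bp : 0 <= B ^+ 2 * p by rewrite mulr_ge0 ?sqr_ge0.
have hX : `|B ^+ 2 - D ^+ 2| <= X.
  rewrite distrC; have := normD_le h (lexx `|- (B ^+ 2 * p)|).
  rewrite normrN (ger0_norm Bp) /X [leRHS]addrC (_ : _ - _ + _ = D ^+ 2 - B ^+ 2)//.
  by ring.
have h1 : `|B - D| * B <= X.
  apply: le_trans hX; rewrite subr_sqr normrM (ger0_norm (x := B + D)); last by pos.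
  by rewrite ler_wpM2l// lerDl.
have h2 : (B - D) ^+ 2 * B ^+ 2 <= X ^+ 2.
  rewrite -[(B - D) ^+ 2]real_normK ?num_real// -exprMn.
  have X0 : 0 <= X by rewrite /X addr_ge0.
  by rewrite ler_pXn2r// nnegrE mulr_ge0// ltW.
have h3 : X ^+ 2 <= B ^+ 2 * (B ^+ 2 * p ^+ 2) + (18 * k + k ^+ 2) * E.
  have -> : X ^+ 2 = B ^+ 2 * (B ^+ 2 * p ^+ 2) + (2 * (B ^+ 2 * p) * (k * E) + k ^+ 2 * (E * E)).
    by rewrite /X; ring.
  rewrite lerD2l (mulrDl (18 * k)) lerD//.
    have : B ^+ 2 * p <= 9.
      have B9 : B ^+ 2 <= 9 by nra.
      by apply: le_trans B9; apply: ler_piMr => //; exact: sqr_ge0.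
    have -> : 18 * k * E = 18 * (k * E) by ring.
    by move=> B9; rewrite ler_wpM2r//; lra.
  by rewrite ler_wpM2l ?sqr_ge0//; nra.
have B2 : 1 <= 9 * B ^+ 2 by nra.
have Z0 : 0 <= (18 * k + k ^+ 2) * E by rewrite mulr_ge0// addr_ge0 ?sqr_ge0// mulr_ge0.
have Bpos : 0 < B ^+ 2 by exact: exprn_gt0.
rewrite -(ler_pM2r Bpos); apply: (le_trans h2); apply: (le_trans h3).
have -> : (B ^+ 2 * p ^+ 2 + 9 * (18 * k + k ^+ 2) * E) * B ^+ 2 =
    B ^+ 2 * (B ^+ 2 * p ^+ 2) + (18 * k + k ^+ 2) * E * (9 * B ^+ 2) by ring.
by rewrite lerD2l ler_peMr.
Qed.

(* The defect is at most [mub * scale * p] with [p = (eps / D) ^ m], and [p ^ 2] is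
   dominated by [eps ^ (m + 1) * D ^ -(m + 1)], a multiple of [eps * D'']: the
   bound integrates exactly. *)
Lemma defect_bound : exists2 C, 0 < C & \forall d \near 0^'+, forall y, 0 <= y <= half ->
  (mub * inner_scale d - D1 (V d) y) ^+ 2 <=
    2 * eps d / m * D2 m (R d) (sigma d) y + C * eps d `^ m.
Proof.
have mb := mubar_gt0 m1; have mb2 : 0 < mub ^+ 2 by exact: exprn_gt0.
pose H := rest_bound m; have H0 : 0 < H by exact: rest_bound_gt0.
pose k1 := 2 * H * (9 / mub ^+ 2); have k10 : 0 < k1 by rewrite /k1; pos.
pose k2 := 9 * (18 * k1 + k1 ^+ 2); have k20 : 0 < k2 by rewrite /k2; pos.
pose k3 := 9 * ((m + 1) / 2) * H; have k30 : 0 < k3 by rewrite /k3; pos.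
exists (k3 + k2); first by pos.
near=> d => y yh; have /andP[y0 y1] := yh.
have [PV [PF [Q w]]] : has_wave d by near: d; exact: has_wave_near.
have s0 := w_s0 w.
have e0 : 0 < eps d by near: d; exact: eps_gt0_near.
have e1 : eps d <= 1 by near: d; exact: eps_small.
have em1 : eps d `^ m <= 1 by near: d; exact: eps_powm_small.
have em0 : 0 < eps d `^ m by exact: powR_gt0.
have [b0 bE /andP[b1 b2]] : [/\ 0 < inner_scale d, inner_scale d ^+ 2 * (sigma d * eps d `^ m) = 1 & 1 / 3 <= mub * inner_scale d <= 3].
  by near: d; exact: inner_scale_spec.
have D10 := D1_ge0 w yh.
have Dp : 0 < 1 - R d y := D_gt0 w y.
have De : eps d <= 1 - R d y := D_mono w (lexx 0) y0.
have Dle := D_le1 w y.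
have en := wave_energy m1 w yh; have d2 := D2_approx m1 w yh.
rewrite -/(eps d) -/H in en d2.
set DD := 1 - R d y in Dp De Dle en d2 *.
have sE : (sigma d)^-1 = inner_scale d ^+ 2 * eps d `^ m.
  by rewrite -[LHS]mulr1 -bE; field; rewrite gt_eqF.
have EN : eps d `^ m * eps d `^ (- m) = 1 by rewrite powRN mulfV// gt_eqF.
set E := eps d `^ m in em0 em1 bE sE EN *.
pose p := E * DD `^ (- m).
have p0 : 0 <= p by rewrite /p; pos.
have p1 : p <= 1.
  rewrite /p -EN ler_pM2l//; apply: powRN_le => //; exact: ltW.
have p2 : p ^+ 2 <= E * (eps d * DD `^ (- (m + 1))).
  have -> : p ^+ 2 = E * (E * (DD `^ (- m) * DD `^ (- m))) by rewrite /p; ring.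
  rewrite ler_pM2l// -powRD ?(gt_eqF Dp) ?implybT//.
  have -> : - m + - m = - (m + 1) + - (m - 1) by ring.
  rewrite (powRD (x := DD)) ?(gt_eqF Dp) ?implybT//.
  have -> : E = eps d * eps d `^ (m - 1) by rewrite mulr_powRB1// ltW.
  rewrite -mulrA ler_pM2l// mulrCA ler_piMr ?powR_ge0//.
  rewrite powRN ler_pdivrMr ?powR_gt0// mul1r.
  by apply: ge0_ler_powR => //; rewrite ?subr_ge0 ?nnegrE ?(ltW m1) ?(ltW e0) ?(ltW Dp).
have h : `|D1 (V d) y ^+ 2 - (mub * inner_scale d) ^+ 2 * (1 - p)| <= k1 * E.
  have -> : D1 (V d) y ^+ 2 - (mub * inner_scale d) ^+ 2 * (1 - p) =
      (sigma d)^-1 * (sigma d * D1 (V d) y ^+ 2 - mub ^+ 2 * (eps d `^ (- m) - DD `^ (- m))).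
    rewrite [RHS]mulrBr mulKf ?gt_eqF// sE /p.
    by rewrite -[X in _ * (X - _)]EN; ring.
  rewrite normrM gtr0_norm ?invr_gt0// {1}sE.
  have bb : inner_scale d ^+ 2 <= 9 / mub ^+ 2.
    rewrite ler_pdivlMr// -exprMn mulrC; have := mulr_gt0 mb b0.
    by move: (mub * inner_scale d) b2 => z *; nra.
  have -> : k1 * E = 9 / mub ^+ 2 * E * (2 * H) by rewrite /k1; ring.
  apply: ler_pM => //; [by pos|by rewrite ler_pM2r|].
  apply: (le_trans en); rewrite -[leRHS]mulr1 ler_pM2l; [lra|by pos].
have := sqr_defect_le b1 b2 D10 p0 p1 (ltW em0) em1 (ltW k10) h.
rewrite -/k2 => /le_trans; apply; rewrite (mulrDl k3) addrA lerD2r.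
move: d2; rewrite ler_norml => /andP[d2 _].
set P := DD `^ (- (m + 1)) in p2 d2.
have P1 : P <= (m + 1) / 2 * (sigma d * D2 m (R d) (sigma d) y + H).
  have -> : P = (m + 1) / 2 * (2 / (m + 1) * P) by field; rewrite gt_eqF.
  rewrite ler_pM2l; last by pos.
  by move: d2; move: (2 / (m + 1) * P) (sigma d * _) => u v *; lra.
set X := D2 _ _ _ _ in P1 *.
have B2 : 0 <= (mub * inner_scale d) ^+ 2 by exact: sqr_ge0.
apply: (@le_trans _ _ ((mub * inner_scale d) ^+ 2 * (E * (eps d * ((m + 1) / 2 * (sigma d * X + H)))))).
  rewrite ler_wpM2l//; apply: (le_trans p2).
  by rewrite ler_pM2l// ler_pM2l.
have -> : (mub * inner_scale d) ^+ 2 * (E * (eps d * ((m + 1) / 2 * (sigma d * X + H)))) =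
   eps d * ((m + 1) / 2) * mub ^+ 2 * X * (inner_scale d ^+ 2 * (sigma d * E)) +
   (mub * inner_scale d) ^+ 2 * eps d * ((m + 1) / 2 * H * E) by ring.
rewrite bE mulr1; have -> : eps d * ((m + 1) / 2) * mub ^+ 2 * X = 2 * eps d / m * X.
  by rewrite mubar2//; field; rewrite (gt_eqF m0) (gt_eqF m10).
rewrite lerD2l; have -> : k3 * E = 9 * ((m + 1) / 2 * H * E) by rewrite /k3; ring.
rewrite ler_wpM2r//; first by pos.
apply: (@le_trans _ _ ((mub * inner_scale d) ^+ 2)); first by apply: ler_piMr => //; exact: ltW.
have := mulr_gt0 mb b0; move: (mub * inner_scale d) b2 => z *; nra.
Unshelve. all: by end_near. Qed.

(** If [a + b = c = B] exactly, then [a ^ 2 + b ^ 2 = (B - (a - b)) ^ 2 / 2 + c * (a - b)]. For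
    [a, b = V (1/2 -+ y)] the last term is [V 0 * D' y], which integrates exactly. *)
Lemma sum_sqr_le (a b c B X F G : K) : 0 <= a <= 2 -> 0 <= b <= 2 -> 0 <= a - b -> 0 <= c <= 2 -> 0 <= B <= 3 ->
  `|a + b - c| <= F -> `|c - B| <= G -> (B - (a - b)) ^+ 2 <= X ->
  a ^+ 2 + b ^+ 2 <= X / 2 + c * (a - b) + 3 * F + 5 / 2 * G.
Proof.
move=> /andP[a0 a2] /andP[b0 b2] ab /andP[c0 c2] /andP[B0 B3] sF cG hX.
have h1 : (a + b - c) * (a + b + c) <= F * 6.
  apply: le_trans (ler_norm _) _; rewrite normrM; apply: ler_pM => //.
  by rewrite ger0_norm; lra.
have h2 : (c - B) * (c + B - 2 * (a - b)) <= G * 5.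
  apply: le_trans (ler_norm _) _; rewrite normrM; apply: ler_pM => //.
  by rewrite ler_norml; apply/andP; split; lra.
have -> : a ^+ 2 + b ^+ 2 = (a + b - c) * (a + b + c) / 2 + (B - (a - b)) ^+ 2 / 2
   + (c - B) * (c + B - 2 * (a - b)) / 2 + c * (a - b) by field.
lra.
Qed.

(* The terms bounded are the leading part of [int_0^1 V ^ 2]; here [c = V 0],
   [i = 1 / m], [Rh = R (1/2)] and [Dh = D' (1/2)]. *)
Lemma unit_interval_le (c e i k F G Rh Dh : K) : 0 <= c <= 2 -> 0 <= e <= 1 -> 0 <= i <= 1 -> 0 <= k -> 0 <= G -> 0 <= F ->
  1 - e <= c -> c <= 1 + e * k + G -> c / 2 - F <= Rh -> Dh <= c ->
  e * i * Dh + c * ((1 - Rh) - e) <= 2^-1 - e * (1 - i) + e ^+ 2 * (1 + k) + G + 2 * F.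
Proof.
move=> /andP[c0 c2] /andP[e0 e1] /andP[i0 i1] k0 G0 F0 c1 ck Rc Dc.
have ei0 : 0 <= e * i by exact: mulr_ge0.
have ei : e * i <= e by exact: ler_piMr.
have ei1 : e * i <= 1 by exact: le_trans ei e1.
have t1 : e * i * Dh <= e * i + e ^+ 2 * k + G.
  apply: (@le_trans _ _ (e * i * (1 + e * k + G))).
    by rewrite ler_wpM2l//; exact: le_trans ck.
  have ek : 0 <= e * k by exact: mulr_ge0.
  have : e * i * (e * k) <= e * (e * k) by rewrite ler_wpM2r.
  have : e * i * G <= 1 * G by rewrite ler_wpM2r.
  by rewrite !mulrDr mulr1 mul1r expr2 -mulrA -!mulrA; lra.
have t2 : c * ((1 - Rh) - e) <= c * (1 - c / 2 - e) + 2 * F.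
  have : c * ((1 - Rh) - e) <= c * (1 - c / 2 - e + F) by rewrite ler_wpM2l//; lra.
  have : c * F <= 2 * F by rewrite ler_wpM2r.
  by rewrite !mulrDr; lra.
have t3 : c * (1 - c / 2 - e) <= 2^-1 - (1 - e) * e.
  have h : (1 - e) * e <= c * e by rewrite ler_wpM2r.
  have -> : c * (1 - c / 2 - e) = 2^-1 - (1 - c) ^+ 2 / 2 - c * e by field.
  by have := sqr_ge0 (1 - c); move: h; lra.
move: t1 t2 t3; rewrite expr2; lra.
Qed.

Lemma eps_le_delta : exists2 C, 0 < C & \forall d \near 0^'+, eps d <= C * d.
Proof.
have mb := mubar_gt0 m1; have pi0 : 0 < pi :> K by exact: pi_gt0.
have [Cm Cm0 HM] := matching.
have [Fc Fc0 HF] := inv_sigma_far.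
have [Cd Cd0 HD] := defect_bound.
pose k := `|kap - 1|; have k0 : 0 <= k by exact: normr_ge0.
pose eta := 1 - m^-1.
have eta0 : 0 < eta by rewrite subr_gt0 invf_lt1.
pose K5 := Cd / 2 + (6 * Fc + 5 / 2 * Cm); have K50 : 0 < K5 by rewrite /K5; pos.
pose K6 := 2 * Cm + 2 * Fc + K5 / 2 + 8 * Fc * pi.
have K60 : 0 < K6 by rewrite /K6; pos.
have k10 : 0 < 1 + k by rewrite ltr_wpDr.
exists (2 / eta); first by pos.
near=> d.
have d01 : 0 < d < 1 by near: d; exact: near01.
have [PV [PF [Q [w QB]]]] := wave_data d01.
have s0 := w_s0 w.
have e0 : 0 < eps d by near: d; exact: eps_gt0_near.
have e1 : eps d <= 1 by near: d; exact: eps_small.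
have ek : eps d <= eta / (4 * (1 + k)) by near: d; apply: eps_small; pos.
have em0 : 0 < eps d `^ m by exact: powR_gt0.
have pe : eps d `^ (m - 1) <= eta / (4 * K6).
  by near: d; apply: eps_pow_small; [rewrite subr_gt0|pos].
have fs : far_force m / sigma d <= Fc * eps d `^ m by near: d; exact: HF.
have [c1 b3] : `|V d 0 - mub * inner_scale d| <= Cm * eps d `^ m /\
    `|mub * inner_scale d - (1 + eps d * (kap - 1))| <= Cm * eps d `^ m by near: d; exact: HM.
have [b0 _ /andP[b1 b2]] : [/\ 0 < inner_scale d, inner_scale d ^+ 2 * (sigma d * eps d `^ m) = 1 & 1 / 3 <= mub * inner_scale d <= 3].
  by near: d; exact: inner_scale_spec.
have HD' : forall y, 0 <= y <= half ->
  (mub * inner_scale d - D1 (V d) y) ^+ 2 <=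
    2 * eps d / m * D2 m (R d) (sigma d) y + Cd * eps d `^ m.
  by near: d; exact: HD.
have sl : linear_force_bound m / sigma d <= 4^-1.
  rewrite ler_pdivrMr// mulrC ler_pdivlMr//; near: d; exact: sigma_large.
have EP : eps d `^ m = eps d * eps d `^ (m - 1) by rewrite mulr_powRB1// ltW.
set E := eps d `^ m in em0 fs c1 b3 HD' EP.
have V1 : V d 1 <= Fc * E by exact: le_trans (V1_le m1 w) fs.
have c02 : 0 <= V d 0 <= 2 by rewrite (w_V0 w) (V0_le m1 w).
have h0 : 0 <= half by rewrite invr_ge0.
(* [f] folds [[0, 1]] at [1/2], so that [f (1/2) = Q 1]; [g] is an antiderivative of the bound
   obtained from [sum_sqr_le] and [defect_bound]. *)
pose f y := Q (half + y) - Q (half - y).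
pose g y := eps d / m * D1 (V d) y + V d 0 * (1 - R d y) + K5 * E * y.
have df (y : K) : is_derive y 1 f (V d (half - y) ^+ 2 + V d (half + y) ^+ 2).
  have d1 : is_derive y 1 (fun z : K => half + z) 1.
    by apply: (der_conv (der_add (der_cst half y) (der_id y))); rewrite add0r.
  have d2 : is_derive y 1 (fun z : K => half - z) (-1).
    by apply: (der_conv (der_add (der_cst half y) (der_opp (der_id y)))); rewrite add0r.
  apply: (der_conv (der_add (@der_comp _ Q _ _ _ _ (w_dQ w _) d1) (der_opp (@der_comp _ Q _ _ _ _ (w_dQ w _) d2)))).
  by ring.
have dg (y : K) : is_derive y 1 g (eps d / m * D2 m (R d) (sigma d) y + V d 0 * D1 (V d) y + K5 * E).
  apply: (der_conv (der_add (der_add (der_mul (der_cst (eps d / m) y) (der_D1 w y)) (der_mul (der_cst (V d 0) y) (der_D w y))) (der_mul (der_cst (K5 * E) y) (der_id y)))).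
  by rewrite -/(D2 _ _ _ _); ring.
have fg y : 0 < y < half -> V d (half - y) ^+ 2 + V d (half + y) ^+ 2 <=
    eps d / m * D2 m (R d) (sigma d) y + V d 0 * D1 (V d) y + K5 * E.
  move=> /andP[y0 y1]; have yh : 0 <= y <= half by rewrite !ltW.
  have D0 := D1_ge0 w yh; have DX := HD' y yh; rewrite (D1E w) in D0 DX *.
  have vs : `|V d (half - y) + V d (half + y) - V d 0| <= 2 * (Fc * E).
    apply: (le_trans (V_sum m1 w yh)); rewrite -[leLHS]mulrA ler_pM2l//.
  have va : 0 <= V d (half - y) <= 2 by rewrite (w_V0 w) (V_le2 m1 w).
  have vb : 0 <= V d (half + y) <= 2 by rewrite (w_V0 w) (V_le2 m1 w).
  have B03 : 0 <= mub * inner_scale d <= 3 by rewrite b2 andbT; pos.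
  apply: le_trans (sum_sqr_le va vb D0 c02 B03 vs c1 DX) _.
  rewrite le_eqVlt; apply/orP; left; apply/eqP; rewrite /K5.
  by move: (D2 _ _ _ _) => X; field; rewrite gt_eqF.
have Q1 : Q 1 <= eps d * m^-1 * D1 (V d) half + V d 0 * ((1 - R d half) - eps d) + K5 * E / 2.
  have := le_incr h0 (fun y _ => df y) (fun y _ => dg y) fg.
  rewrite /f /g (D1_0 w) !addr0 !subr0 !subrr (w_Q0 w) !subr0 (_ : half + half = 1); last by field.
  by move=> /le_trans; apply; rewrite le_eqVlt; apply/orP; left; apply/eqP; rewrite /amplitude; ring.
have Q1' : Q 1 <= 2^-1 - eps d * eta + eps d ^+ 2 * (1 + k) + 2 * Cm * E + 2 * (Fc * E) + K5 * E / 2.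
  apply: (le_trans Q1); rewrite lerD2r.
  apply: unit_interval_le => //.
  - by rewrite e1 andbT ltW.
  - by rewrite invr_ge0 (ltW m0) invf_le1// ltW.
  - by pos.
  - by pos.
  - exact: V0_ge w.
  - rewrite -[2 * Cm * E]mulrA; have : eps d * (kap - 1) <= eps d * k by rewrite ler_pM2l// ler_norm.
    move: c1 b3; rewrite !ler_norml => /andP[_ x1] /andP[_ x2].
    by move: x1 x2; move: (mub * inner_scale d) (Cm * E) (eps d * k) (eps d * (kap - 1)) => u v z t *; lra.
  - have := le_trans (R_half_V0 m1 w) fs; rewrite ler_norml => /andP[x1 _].
    by move: x1; move: (Fc * E) => u; lra.
  - by rewrite (D1_half w) gerBl (w_V0 w).
(* Beyond [1], [V ^ 2 <= 2 * V <= 16 * V 1 * bump], and [bump] integrates to at most [pi / 2] on the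
   half-line. *)
have QT (n : nat) : Q n%:R <= Q 1 + 8 * Fc * pi * E.
  have A0 : 0 < 8 * Fc * pi * E by pos.
  case: n => [|n].
    have : 0 <= Q 1.
      have := @ge_incr_cst _ Q _ 0 1 0 ler01 (fun x _ => w_dQ w x) (fun x _ => sqr_ge0 _).
      by rewrite mul0r (w_Q0 w) subr0.
    by rewrite (w_Q0 w); lra.
  have n1 : 1 <= n.+1%:R :> K by rewrite ler1n.
  have := @le_incr _ Q (fun x => 16 * (Fc * E) * atan x) _ (fun x => 16 * (Fc * E) * bump x) 1 n.+1%:R n1
    (fun x _ => w_dQ w x).
  move=> H; rewrite -lerBlDl; apply: le_trans (H _ _) _.
  - move=> x /andP[x1 _]; have vt := V_tail m1 w sl (ltW x1).
    have v2 := V_le2 m1 w x; have v0 := w_V0 w x.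
    apply: (@le_trans _ _ (2 * V d x)); first by rewrite expr2 ler_wpM2r.
    have bp := bump_gt0 x.
    have : V d 1 * bump x <= Fc * E * bump x by rewrite ler_pM2r.
    by move: vt; rewrite -!mulrA; move: (V d 1 * bump x) (Fc * (E * bump x)) => u v *; lra.
  - rewrite -mulrBr; have -> : 8 * Fc * pi * E = 16 * (Fc * E) * (pi / 2) by field.
    rewrite ler_pM2l; last by pos.
    have := atan_ltpi2 (n.+1%:R : K); have : atan 1 >= 0 :> K by rewrite atan1; pos.
    by lra.
have := QB _ QT.
(* Each of the two errors takes a quarter of [eps * eta]; then [(1 - d) ^ 2 <= 1 - eps * eta], so
   [eps * eta <= 2 * d], whence the constant [2 / eta]. *)
have E6 : K6 * E <= eps d * eta / 4.
  have -> : K6 * E = eps d * (K6 * eps d `^ (m - 1)) by rewrite EP; ring.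
  rewrite -mulrA ler_pM2l//; move: pe; rewrite ler_pdivlMr; last by pos.
  by move: (eps d `^ _) => P; lra.
have e2 : eps d ^+ 2 * (1 + k) <= eps d * eta / 4.
  rewrite expr2 -!mulrA ler_pM2l//; move: ek; rewrite ler_pdivlMr; last by pos.
  by move: (eps d) => P; lra.
move=> h; rewrite mulrAC ler_pdivlMr//.
have Q1'' : Q 1 + 8 * Fc * pi * E <= 2^-1 - eps d * eta + eps d ^+ 2 * (1 + k) + K6 * E.
  move: Q1'; rewrite /K6; move: (eps d * eta) (eps d ^+ 2 * _) => u v; lra.
move: h Q1'' E6 e2; move: (Q 1 + _) (eps d * eta) (eps d ^+ 2 * _) (K6 * E) => q u v t h q1 e6 e2.
have := sqr_ge0 d; move: h; rewrite !expr2; lra.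
Unshelve. all: by end_near. Qed.

End family.

Theorem theorem16 (K : realType) (m : K) (S0 : K -> K)
    (V R : K -> K -> K) (sigma : K -> K) (q : \bar K) :
  1 < m ->
  is_S0 m S0 ->
  high_energy_family m V R sigma ->
  (1 <= q)%E ->
  let eps := amplitude R in
  (exists C : K, \forall delta \near 0^'+,
     ('N[@lebesgue_measure K]_q
          [EFin \o (R delta \- Rhat m S0 (eps delta))%R]
      + 'N[@lebesgue_measure K]_q
          [EFin \o (V delta \- Vhat m S0 (eps delta))%R]
      + (eps delta `^ m * `|sigma delta - sigmahat m S0 (eps delta)|)%:E
      <= (C * eps delta `^ m)%:E)%E)
  /\ (exists C : K, \forall delta \near 0^'+,
     eps delta `^ m <= C * delta `^ m).
Proof.
move=> m1 hS hF q1 eps; have m0 : 0 < m := lt_trans ltr01 m1; split.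
  have [C1 C10 H1] := pointwise m1 hS hF.
  have [C2 C20 H2] := sigma_approx m1 hS hF.
  exists (C1 * (1 + pi) + C1 * (1 + pi) + C2); near=> d.
  have h1 : forall x,
    `|R d x - Rhat m S0 (eps d) x| <= C1 * eps d `^ m * bump x /\
    `|V d x - Vhat m S0 (eps d) x| <= C1 * eps d `^ m * bump x by near: d; exact: H1.
  have h2 : eps d `^ m * `|sigma d - sigmahat m S0 (eps d)| <= C2 * eps d `^ m.
    by near: d; exact: H2.
  have e0 : 0 < eps d by near: d; exact: eps_gt0_near m1 hF.
  have c0 : 0 <= C1 * eps d `^ m by rewrite mulr_ge0 ?powR_ge0// ltW.
  rewrite !mulrDl !EFinD; apply: leeD; last by rewrite lee_fin.
  by apply: leeD; rewrite mulrAC; apply: Lnorm_decay => // x; case: (h1 x).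
have [C C0 H] := eps_le_delta m1 hS hF.
exists (C `^ m); near=> d.
have d0 : 0 < d by near: d; exact: nbhs_right_gt.
have e0 : 0 < eps d by near: d; exact: eps_gt0_near m1 hF.
have h : eps d <= C * d by near: d; exact: H.
rewrite -(powRM m (ltW C0) (ltW d0)); apply: ge0_ler_powR (ltW m0) _ _ _ _ h; rewrite nnegrE.
- exact: ltW.
- exact: mulr_ge0 (ltW C0) (ltW d0).
Unshelve. all: by end_near. Qed.
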